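(* Let $k$ be a field of characteristic different from $2$, let $G$ be a group with an involution $\ast$, and let $N$ be a $\ast$-invariant normal subgroup of $G$ such that $G/N$ is a nonabelian torsion-free nilpotent group. Let $D$ be a division ring and $k[G]\hookrightarrow D$ an embedding which is a good embedding for $k[N]$, and suppose that the $k$-involution on $k[G]$ induced by $\ast$ extends to a $k$-involution of $D$. Then $D_G$ contains a free symmetric pair with respect to this $k$-involution.
   Context: An involution on a group is an anti-automorphism of order $2$; a $k$-involution on a $k$-algebra is a $k$-linear map $\ast$ with $(xy)^\ast=y^\ast x^\ast$, $(x^\ast)^\ast=x$; the $k$-linear extension of a group involution to $k[G]$ is a $k$-involution. A free symmetric pair is a pair $u,v$ with $u^\ast=u$, $v^\ast=v$ generating a free subgroup of rank $2$ of the multiplicative group. If $k[G]$ embeds in a division ring $D$ and $H\le G$, $D_H$ denotes the division subring of $D$ generated by $k[H]$. For a normal subgroup $N$ of $G$, the embedding $k[G]\hookrightarrow D$ is a good embedding for $k[N]$ if: (i) $G/N$ is orderable (admits a total order invariant under left and right multiplication); (ii) for every division ring $F$, every crossed product $F[\overline{G/N};\sigma,\tau]$ (free left $F$-module on a copy $\overline{G/N}$ of $G/N$ with $\overline{\alpha}r=r^{\sigma(\alpha)}\overline{\alpha}$, $\overline{\alpha}\,\overline{\beta}=\tau(\alpha,\beta)\overline{\alpha\beta}$ for maps $\sigma\colon G/N\to\operatorname{Aut}(F)$, $\tau\colon G/N\times G/N\to F^\bullet$, associative) is an Ore domain; (iii) there is a left transversal $\{x_\alpha\}_{\alpha\in G/N}$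 of $N$ in $G$ which is left linearly independent over $D_N$. *)

(* Defs.v *)
From HB Require Import structures.
From mathcomp Require Import all_boot all_order all_algebra.
From Stdlib Require List.
Set Implicit Arguments. Unset Strict Implicit. Unset Printing Implicit Defensive.
Import GRing.Theory.
Local Open Scope ring_scope.

Record group := Group {
  gcar :> Type;
  gmul : gcar -> gcar -> gcar;
  gone : gcar;
  ginv : gcar -> gcar;
  gmulA : forall x y z, gmul x (gmul y z) = gmul (gmul x y) z;
  gmul1 : forall x, gmul gone x = x;
  gmulV : forall x, gmul (ginv x) x = gone }.
Arguments gmul {g}. Arguments gone {g}. Arguments ginv {g}.

Definition group_hom (G H : group) (f : G -> H) : Prop :=
  forall x y, f (gmul x y) = gmul (f x) (f y).

Definition subgroup (G : group) (N : G -> Prop) : Prop :=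
  [/\ N gone, (forall x y, N x -> N y -> N (gmul x y)) & (forall x, N x -> N (ginv x))].

Definition normal_subgroup (G : group) (N : G -> Prop) : Prop :=
  subgroup N /\ forall g x, N x -> N (gmul (gmul (ginv g) x) g).

Definition group_involution (G : group) (s : G -> G) : Prop :=
  (forall x y, s (gmul x y) = gmul (s y) (s x)) /\ (forall x, s (s x) = x).

Definition gcomm (G : group) (x y : G) : G :=
  gmul (gmul (ginv x) (ginv y)) (gmul x y).

Inductive gen_sub (G : group) (S : G -> Prop) : G -> Prop :=
  | gen_in x : S x -> gen_sub S x
  | gen_one : gen_sub S gone
  | gen_mul x y : gen_sub S x -> gen_sub S y -> gen_sub S (gmul x y)
  | gen_inv x : gen_sub S x -> gen_sub S (ginv x).

(* lower central series: lcs 0 = G = gamma_1, lcs (n+1) = [lcs n, G] *)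
Fixpoint lcs (G : group) (n : nat) : G -> Prop :=
  match n with
  | 0 => fun _ => True
  | n'.+1 => gen_sub (fun z => exists x y, lcs n' x /\ z = gcomm x y)
  end.

Definition nilpotent_group (G : group) : Prop :=
  exists n, forall x : G, lcs n x -> x = gone.

Fixpoint gpow (G : group) (x : G) (n : nat) : G :=
  match n with 0 => gone | n'.+1 => gmul x (gpow x n') end.

Definition torsion_free (G : group) : Prop :=
  forall (x : G) n, (0 < n)%N -> gpow x n = gone -> x = gone.

Definition nonabelian (G : group) : Prop :=
  exists x y : G, gmul x y <> gmul y x.

Definition orderable (G : group) : Prop :=
  exists le : G -> G -> Prop,
    [/\ (forall x, le x x),
        (forall x y, le x y -> le y x -> x = y),
        (forall x y z, le x y -> le y z -> le x z),
        (forall x y, le x y \/ le y x) &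
        (forall x y z, le x y -> le (gmul z x) (gmul z y) /\ le (gmul x z) (gmul y z))].

Definition is_division_ring (D : unitRingType) : Prop :=
  forall x : D, x != 0 -> x \is a GRing.unit.

Definition ore_domain (R : nzRingType) : Prop :=
  [/\ (forall x y : R, x * y = 0 -> x = 0 \/ y = 0),
      (forall a b : R, a != 0 -> b != 0 -> exists r s : R, r * a = s * b /\ r * a != 0) &
      (forall a b : R, a != 0 -> b != 0 -> exists r s : R, a * r = b * s /\ a * r != 0)].

(* R (with the embedding iota of F and the basis u) is the crossed product
   F[Q; sigma, tau]: R is the free left F-module on {u a}, with
   u a * f = sigma a f * u a and u a * u b = tau a b * u (a b). *)
Definition is_crossed_product (F : unitRingType) (Q : group)
    (sigma : Q -> F -> F) (tau : Q -> Q -> F)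
    (R : nzRingType) (iota : F -> R) (u : Q -> R) : Prop :=
  [/\
      (forall a, [/\ bijective (sigma a), sigma a 1 = 1,
                  (forall x y, sigma a (x + y) = sigma a x + sigma a y) &
                  (forall x y, sigma a (x * y) = sigma a x * sigma a y)]),
      (forall a b, tau a b != 0),
      [/\ injective iota, iota 1 = 1,
          (forall x y, iota (x + y) = iota x + iota y) &
          (forall x y, iota (x * y) = iota x * iota y)],
      (forall r : R, exists (s : seq Q) (c : Q -> F),
          List.NoDup s /\ r = \sum_(a <- s) iota (c a) * u a) /\
      (forall (s : seq Q) (c : Q -> F), List.NoDup s ->
          \sum_(a <- s) iota (c a) * u a = 0 -> forall a, List.In a s -> c a = 0) &
      (forall a f, u a * iota f = iota (sigma a f) * u a) /\
      (forall a b, u a * u b = iota (tau a b) * u (gmul a b))].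

(* phi : G -> D induces an embedding k[G] -> D *)
Definition group_algebra_embedding (k : fieldType) (D : unitAlgType k)
    (G : group) (phi : G -> D) : Prop :=
  [/\ phi gone = 1,
      (forall x y, phi (gmul x y) = phi x * phi y) &
      (forall (s : seq G) (c : G -> k), List.NoDup s ->
          \sum_(g <- s) c g *: phi g = 0 -> forall g, List.In g s -> c g = 0)].

Inductive divsub (k : fieldType) (D : unitAlgType k) (G : group)
    (phi : G -> D) (H : G -> Prop) : D -> Prop :=
  | ds_scal (a : k) : divsub phi H (a%:A)
  | ds_grp g : H g -> divsub phi H (phi g)
  | ds_add x y : divsub phi H x -> divsub phi H y -> divsub phi H (x + y)
  | ds_opp x : divsub phi H x -> divsub phi H (- x)
  | ds_mul x y : divsub phi H x -> divsub phi H y -> divsub phi H (x * y)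
  | ds_inv x : divsub phi H x -> x != 0 -> divsub phi H (x^-1).

Definition k_involution (k : fieldType) (D : unitAlgType k) (st : D -> D) : Prop :=
  [/\ (forall x y, st (x + y) = st x + st y),
      (forall (a : k) x, st (a *: x) = a *: st x),
      (forall x y, st (x * y) = st y * st x) &
      (forall x, st (st x) = x)].

(* u, v generate a free subgroup of rank 2 of D^*: they are units and no
   nonempty reduced word in u^{+-1}, v^{+-1} evaluates to 1.
   A letter (b, e): b = true means u, false means v; e = true means exponent +1. *)
Fixpoint reduced_word (w : seq (bool * bool)) : bool :=
  match w with
  | (b1, e1) :: (((b2, e2) :: _) as w') =>
      ~~ ((b1 == b2) && (e1 != e2)) && reduced_word w'
  | _ => true
  end.

Definition eval_word (R : unitRingType) (u v : R) (w : seq (bool * bool)) : R :=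
  foldr (fun l acc => (let x := if l.1 then u else v in
                       if l.2 then x else x^-1) * acc) 1 w.

Definition free_pair (R : unitRingType) (u v : R) : Prop :=
  [/\ u \is a GRing.unit, v \is a GRing.unit &
      forall w, w != [::] -> reduced_word w -> eval_word u v w != 1].

(* Main.v *)
(** Let [th g := (st g)^-1], with [st] the involution: this is an automorphism of
    [Q = G/N] of order at most two.  Replacing [g] by [g * th g] pushes the defect [g^-1 * th g] down the lower
    central series, so one finds [x] in the second center and [y], not commuting
    with [x], such that [th x = x^{+-1}] and [th y = y^{+-1}]; the commutator
    [z = [x, y]] is central of infinite order.

    Let [K] be the division ring generated by [N], [z] and [x].  By (iii) and the
    left Ore condition for skew polynomials, the powers of [t = y] are left
    independent over [K], so [K[t]] carries a [t]-adic filtration.  Elements of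
    the ring generated by [k[G]] and inverses of [1 +] (terms of positive degree
    in [t]) expand as power series in [t] with coefficients in [k[G]].  These can
    be specialized by [N -> 1], [z -> -1], [x -> diag(1, -1)] and
    [y -> tau * antidiag(1, 1)], giving matrices over the rational functions in
    [tau].

    If [st y = y] modulo [N] put [s = (y + st y) / 2], otherwise [s = 2 (y + st y)^-1];
    in both cases [s] is symmetric of positive degree.  With [b = (x + st x) / 2] the
    pair is [u = 1 + s] and [v = 1 + s b s].  At [tau = 1] the specializations of
    [u], [v] and their adjugates become, up to nonzero scalars, the rank one
    matrices [1 +- y], [1 -+ x], whose products along reduced words have rank one,
    because 2 is invertible; hence no nonempty reduced word can equal 1. *)
Require Import Defs.
From HB Require Import structures.
From mathcomp Require Import all_boot all_order all_algebra.
From mathcomp Require Import boolp.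
From Stdlib Require List.
Set Implicit Arguments. Unset Strict Implicit. Unset Printing Implicit Defensive.
Import GRing.Theory.
Local Open Scope ring_scope.

(** * Identities derived from the one-sided group axioms *)

Section GroupTheory.
Variable G : group.
Implicit Types x y z g h : G.

Lemma gmulgV x : gmul x (ginv x) = gone.
Proof.
rewrite -(gmul1 (gmul x _)) -(gmulV (ginv x)) -gmulA.
by rewrite (gmulA (ginv x)) gmulV gmul1.
Qed.

Lemma gmulg1 x : gmul x gone = x.
Proof. by rewrite -(gmulV x) gmulA gmulgV gmul1. Qed.

Lemma gmulKg x y : gmul (ginv x) (gmul x y) = y.
Proof. by rewrite gmulA gmulV gmul1. Qed.

Lemma gmulVKg x y : gmul x (gmul (ginv x) y) = y.
Proof. by rewrite gmulA gmulgV gmul1. Qed.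

Lemma gmulI x y z : gmul x y = gmul x z -> y = z.
Proof. by move=> e; rewrite -(gmulKg x y) e gmulKg. Qed.

Lemma gmulIg x y z : gmul y x = gmul z x -> y = z.
Proof. by move=> e; rewrite -(gmulg1 y) -(gmulgV x) gmulA e -gmulA gmulgV gmulg1. Qed.

Lemma ginvK x : ginv (ginv x) = x.
Proof. by apply: (@gmulI (ginv x)); rewrite gmulgV gmulV. Qed.

Lemma ginvM x y : ginv (gmul x y) = gmul (ginv y) (ginv x).
Proof.
by apply: (@gmulI (gmul x y)); rewrite gmulgV -gmulA gmulVKg gmulgV.
Qed.

Lemma ginv1 : ginv gone = gone :> G.
Proof. by rewrite -[LHS]gmul1 gmulgV. Qed.

End GroupTheory.

Ltac gsimp := repeat first
  [ rewrite ginvM | rewrite ginvK | rewrite ginv1 | rewrite gmul1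
  | rewrite gmulg1 | rewrite gmulV | rewrite gmulgV | rewrite gmulKg
  | rewrite gmulVKg | rewrite -gmulA ].

Section Homs.
Variables (G H : group) (f : G -> H).
Hypothesis f_hom : group_hom f.

Lemma ghom1 : f gone = gone.
Proof. by apply: (@gmulI _ (f gone)); rewrite -f_hom !gmulg1. Qed.

Lemma ghomV x : f (ginv x) = ginv (f x).
Proof. by apply: (@gmulI _ (f x)); rewrite -f_hom !gmulgV ghom1. Qed.

End Homs.

(** * Commuting elements and integer powers *)

Section Powers.
Variable G : group.
Implicit Types x y z g h : G.

Definition gcommutes x y := gmul x y = gmul y x.

Lemma gcommutesV x y : gcommutes x y -> gcommutes x (ginv y).
Proof.
move=> c; apply: (@gmulI _ y); apply: (@gmulIg _ y).
by gsimp.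
Qed.

Lemma gcommutesM x y z : gcommutes x y -> gcommutes x z -> gcommutes x (gmul y z).
Proof. by rewrite /gcommutes => cy cz; rewrite gmulA cy -gmulA cz gmulA. Qed.

Lemma gcommutes1 x : gcommutes x gone.
Proof. by rewrite /gcommutes gmulg1 gmul1. Qed.

Definition zpow x (i : int) : G :=
  match i with Posz n => gpow x n | Negz n => ginv (gpow x n.+1) end.

Lemma gcommutes_zpow x y i : gcommutes x y -> gcommutes x (zpow y i).
Proof.
move=> c; have cp n : gcommutes x (gpow y n).
  by elim: n => [|n IH]; [exact: gcommutes1 | exact: gcommutesM].
by case: i => n; [exact: cp | exact: gcommutesV].
Qed.

Lemma zpowS x i : zpow x (i + 1) = gmul x (zpow x i).
Proof.
have cp n : gcommutes x (gpow x n) by apply: (@gcommutes_zpow _ _ (Posz n)).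
case: i => [n|[|n]]; first by rewrite -PoszD addn1.
  by rewrite /= gmulg1 gmulgV.
have -> : (Negz n.+1 + 1 = Negz n)%R by rewrite !NegzE -[n.+2]addn1 PoszD opprD addrNK.
by rewrite /= [in RHS]cp; gsimp.
Qed.

Lemma zpowD x i j : zpow x (i + j) = gmul (zpow x i) (zpow x j).
Proof.
elim: i => [|n IH|n IH]; first by rewrite add0r /= gmul1.
  by rewrite -[n.+1]addn1 PoszD addrAC !zpowS IH gmulA.
apply: (@gmulI _ x); rewrite gmulA -!zpowS.
have -> : - (n.+1)%:Z + 1 = - n%:Z by rewrite -[n.+1]addn1 PoszD opprD addrNK.
by rewrite addrAC -IH; congr (zpow _ (_ + _)); rewrite -[n.+1]addn1 PoszD opprD addrNK.
Qed.

Lemma zpow_mulg x y i : gcommutes x y -> zpow (gmul x y) i = gmul (zpow x i) (zpow y i).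
Proof.
move=> c; have mulS j : zpow (gmul x y) j = gmul (zpow x j) (zpow y j) <->
    zpow (gmul x y) (j + 1) = gmul (zpow x (j + 1)) (zpow y (j + 1)).
  have e : gmul (zpow x (j + 1)) (zpow y (j + 1)) =
           gmul (gmul x y) (gmul (zpow x j) (zpow y j)).
    rewrite !zpowS -!gmulA; congr gmul; rewrite !gmulA; congr gmul.
    by symmetry; apply: gcommutes_zpow.
  by rewrite e zpowS; split=> [-> //|/gmulI ->].
elim: i => [|n IH|n IH]; first by rewrite /= gmul1.
  by rewrite -[n.+1]addn1 PoszD; apply: (proj1 (mulS _)).
by apply: (proj2 (mulS _)); rewrite -[n.+1]addn1 PoszD opprD addrNK.
Qed.

Lemma zpowM x i j : zpow (zpow x i) j = zpow x (i * j).
Proof.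
elim: j => [|n IH|n IH]; first by rewrite mulr0.
  by rewrite -[n.+1]addn1 PoszD zpowS IH mulrDr mulr1 addrC zpowD.
apply: (@gmulI _ (zpow x i)); rewrite -zpowS -zpowD.
rewrite -[n.+1]addn1 PoszD opprD addrNK IH.
by rewrite mulrDr mulrN1 addrCA subrr addr0.
Qed.

Lemma zpowV x : zpow x (-1) = ginv x.
Proof. by rewrite /= gmulg1. Qed.

Lemma zpow1 x : zpow x 1 = x.
Proof. by rewrite /= gmulg1. Qed.

Lemma zpow_eq1 x i : torsion_free G -> x <> gone -> zpow x i = gone -> i = 0.
Proof.
move=> tf nx; case: i => [[|n]|n] //= e.
  by case: nx; apply: (tf x n.+1).
by case: nx; apply: (tf x n.+1) => //=; rewrite -[LHS]ginvK e ginv1.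
Qed.

Lemma zpow_inj x i j : torsion_free G -> x <> gone -> zpow x i = zpow x j -> i = j.
Proof.
move=> tf nx e; apply/eqP; rewrite -subr_eq0; apply/eqP.
apply: (@zpow_eq1 x) => //; apply: (@gmulIg _ (zpow x j)).
by rewrite -zpowD subrK gmul1.
Qed.

End Powers.

Lemma zpow_hom (G H : group) (f : G -> H) x i :
  group_hom f -> f (zpow x i) = zpow (f x) i.
Proof.
move=> fh; have fp n : f (gpow x n) = gpow (f x) n.
  by elim: n => [|n IH]; [exact: ghom1 | rewrite /= fh IH].
by case: i => n /=; rewrite ?ghomV //= ?fh fp.
Qed.

(** * Normal forms in Heisenberg groups *)

Section Heisenberg.
Variables (G : group) (x y z : G).
Hypotheses (zx : gcommutes x z) (zy : gcommutes y z).
Hypothesis xy : gmul x y = gmul (gmul y x) z.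

Definition heis_nf (i l j : int) : G :=
  gmul (zpow x i) (gmul (zpow z l) (zpow y j)).

(** Conjugation by [x] is an endomorphism sending [y] to [y z^-1], so [y^-j x y^j = x z^j];
    conjugating [x^i] by [y^j] then gives all exponents without a double induction. *)
Lemma heis_commute i j :
  gmul (zpow x i) (zpow y j) = gmul (zpow y j) (gmul (zpow x i) (zpow z (i * j))).
Proof.
pose f g h : G := gmul (ginv g) (gmul h g).
have fh g : group_hom (f g) by move=> a b; rewrite /f; gsimp.
have e1 : f x y = gmul y (ginv z).
  apply: (@gmulI _ x); rewrite /f gmulVKg; apply: (@gmulIg _ z).
  by rewrite -!gmulA gmulV gmulg1 xy gmulA.
have e2 : f (zpow y j) x = gmul x (zpow z j).
  have /= := zpow_hom y j (fh x); rewrite e1 zpow_mulg; last exact: gcommutesV.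
  have -> : zpow (ginv z) j = ginv (zpow z j).
    by rewrite -zpowV zpowM mulN1r -mulrN1 -zpowM zpowV.
  rewrite /f => e; apply: (@gmulI _ (zpow y j)); rewrite gmulVKg.
  have : gmul x (gmul (gmul (ginv x) (gmul (zpow y j) x)) (zpow z j)) =
         gmul x (gmul (gmul (zpow y j) (ginv (zpow z j))) (zpow z j)) by rewrite e.
  by gsimp => <-.
apply: (@gmulI _ (ginv (zpow y j))); rewrite gmulKg.
rewrite -/(f (zpow y j) (zpow x i)) zpow_hom // e2 zpow_mulg; last exact: gcommutes_zpow.
by rewrite zpowM mulrC.
Qed.

(** Moving [x^i'] to the left past [y^j] costs the central factor [z^(-i' j)]. *)
Lemma heis_nfM i l j i' l' j' :
  gmul (heis_nf i l j) (heis_nf i' l' j') =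
  heis_nf (i + i') (l + l' - i' * j) (j + j').
Proof.
have yz a b : gcommutes (zpow y a) (zpow z b).
  apply: gcommutes_zpow; symmetry; apply: gcommutes_zpow; exact/esym.
have xz a b : gcommutes (zpow x a) (zpow z b).
  apply: gcommutes_zpow; symmetry; apply: gcommutes_zpow; exact/esym.
have yx : gmul (zpow y j) (zpow x i') =
    gmul (zpow x i') (gmul (zpow y j) (zpow z (- (i' * j)))).
  rewrite gmulA heis_commute -!gmulA; congr gmul.
  by rewrite -zpowD subrr /= gmulg1.
rewrite /heis_nf !zpowD -!gmulA; congr gmul.
rewrite (gmulA (zpow y j)) yx -!gmulA.
rewrite (gmulA (zpow z l)) -xz -!gmulA; congr gmul; congr gmul.
rewrite (gmulA (zpow z (- _))) -zpowD addrC zpowD.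
by rewrite !gmulA yz -!gmulA; congr gmul; rewrite !gmulA yz.
Qed.

(** Moving [x] past the normal form produces [z^j], moving [y] past [x^i z^l] produces [z^i], and
    [z] has infinite order; so the exponents are recovered one by one. *)
Lemma heis_nf_inj i l j i' l' j' : torsion_free G -> z <> gone ->
  heis_nf i l j = heis_nf i' l' j' -> [/\ i = i', l = l' & j = j'].
Proof.
move=> tf nz.
have yz a b : gcommutes (zpow y a) (zpow z b).
  apply: gcommutes_zpow; symmetry; apply: gcommutes_zpow; exact/esym.
have xz a b : gcommutes (zpow x a) (zpow z b).
  apply: gcommutes_zpow; symmetry; apply: gcommutes_zpow; exact/esym.
have cx a b c : gmul x (heis_nf a b c) = gmul (heis_nf a b c) (gmul x (zpow z c)).
  have xc : gmul x (zpow y c) = gmul (zpow y c) (gmul x (zpow z c)).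
    by have := heis_commute 1 c; rewrite zpow1 mul1r.
  rewrite /heis_nf gmulA (gcommutes_zpow a (erefl : gcommutes x x)) -!gmulA.
  congr gmul; rewrite -xc !gmulA; congr gmul; exact: gcommutes_zpow.
have cy a b : gmul (gmul (zpow x a) (zpow z b)) y =
    gmul y (gmul (gmul (zpow x a) (zpow z b)) (zpow z a)).
  rewrite -!gmulA -{1}[y]zpow1 -yz zpow1 gmulA -{1}[y]zpow1 heis_commute zpow1 mulr1.
  by rewrite -!zpowD -!gmulA -zpowD addrC.
move=> e; have ej : j = j'.
  have := cx i l j; rewrite e cx => /gmulI /gmulI /zpow_inj ej.
  by symmetry; apply: ej.
move: e; rewrite -ej /heis_nf !gmulA => /gmulIg e.
have ei : i = i'.
  have := cy i l; rewrite e cy => /gmulI /gmulI /zpow_inj ei.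
  by symmetry; apply: ei.
by move: e; rewrite -ei => /gmulI /zpow_inj ->.
Qed.

End Heisenberg.

(** * The second center and involutions of nilpotent groups *)

Section NilpotentInvolution.
Variable Q : group.
Implicit Types x y z g h : Q.

(* Locked, as rewriting with associativity would otherwise unfold commutators. *)
Definition lcomm x y : Q := locked (gcomm x y).
Definition gcentral z := forall g, gcommutes g z.
Definition gcentral2 x := forall g, gcentral (lcomm x g).

Lemma gcommD x y : lcomm x y = gmul (gmul (ginv x) (ginv y)) (gmul x y).
Proof. by rewrite /lcomm; unlock. Qed.

Lemma gcommE x y : gmul x y = gmul (gmul y x) (lcomm x y).
Proof. by rewrite gcommD; gsimp. Qed.

Lemma gcomm_eq1 x y : lcomm x y = gone -> gcommutes x y.
Proof. by rewrite /gcommutes gcommE => ->; rewrite gmulg1. Qed.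

Lemma commutes_gcomm x y : gcommutes x y -> lcomm x y = gone.
Proof. by move=> c; apply: (@gmulI _ (gmul y x)); rewrite -gcommE gmulg1. Qed.

Lemma gcentral1 : gcentral (gone : Q).
Proof. by move=> g; apply: gcommutes1. Qed.

Lemma gcentralM z z' : gcentral z -> gcentral z' -> gcentral (gmul z z').
Proof. by move=> cz cz' g; apply: gcommutesM. Qed.

Lemma gcentralV z : gcentral z -> gcentral (ginv z).
Proof. by move=> cz g; apply: gcommutesV. Qed.

Lemma gcommMr x g h : gcentral2 x -> lcomm x (gmul g h) = gmul (lcomm x g) (lcomm x h).
Proof.
move=> cx; have := cx g h; rewrite /gcommutes => e.
have : gmul (gmul x g) h = gmul (gmul (gmul g h) x) (gmul (lcomm x g) (lcomm x h)).
  rewrite (gcommE x g) -gmulA -e -!gmulA; congr gmul.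
  rewrite [in LHS]gmulA (gcommE x h) -!gmulA; congr gmul; congr gmul.
  exact: (cx g (lcomm x h)).
by rewrite -gmulA gcommE => /gmulI.
Qed.

Lemma gcommVr x g : gcentral2 x -> lcomm x (ginv g) = ginv (lcomm x g).
Proof.
move=> cx; apply: (@gmulI _ (lcomm x g)); rewrite -gcommMr // !gmulgV.
exact/commutes_gcomm/gcommutes1.
Qed.

Lemma gsquare_eq1 g : torsion_free Q -> gmul g g = gone -> g = gone.
Proof. by move=> tf e; apply: (tf g 2) => //=; rewrite gmulg1. Qed.

(** If [[x, a][x, b]] and [[x, a][x, b]^-1] are trivial, so is their product [[x, a]^2]. This is the
    isolation property that [involutive_eigenelement] asks of [C]. *)
Lemma centralizer_isolated x a b : torsion_free Q -> gcentral2 x ->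
  gcommutes x (gmul a b) -> gcommutes x (gmul a (ginv b)) -> gcommutes x a.
Proof.
move=> tf cx /commutes_gcomm; rewrite gcommMr // => e1 /commutes_gcomm.
rewrite gcommMr // gcommVr // => e2; apply/gcomm_eq1/gsquare_eq1 => //.
have := cx a (lcomm x b); rewrite /gcommutes => c.
transitivity (gmul (gmul (lcomm x a) (lcomm x b)) (gmul (lcomm x a) (ginv (lcomm x b)))).
  by rewrite -gmulA (gmulA (lcomm x b)) c -!gmulA gmulgV gmulg1.
by rewrite e1 e2 gmul1.
Qed.

(** Centrality of [a b] turns the product of [a b^-1] and [a b] into [a^2], which is therefore
    central; as [[a, g]] is central too, [a^2 g = g a^2 [a, g]^2] forces [[a, g]^2 = 1]. *)
Lemma center_isolated a b : torsion_free Q -> gcentral2 a -> gcentral2 b ->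
  gcentral (gmul a b) -> gcentral (gmul a (ginv b)) -> gcentral a.
Proof.
move=> tf ca cb cab caV.
have eaa : gmul a a = gmul (gmul a (ginv b)) (gmul a b).
  by rewrite -gmulA (cab (ginv b)); gsimp.
have caa : gcentral (gmul a a) by rewrite eaa; apply: gcentralM.
move=> g; symmetry; apply/gcomm_eq1/gsquare_eq1 => //.
have /gmulI : gmul (gmul g a) a = gmul (gmul g a) (gmul a (gmul (lcomm a g) (lcomm a g))).
  rewrite -gmulA caa -gmulA (gcommE a g) !gmulA (gcommE a g) -!gmulA.
  congr gmul; congr gmul; by rewrite !gmulA (ca g a).
by rewrite -{1}[a]gmulg1 => /gmulI.
Qed.

(** The deepest non-central term of the lower central series has its commutators in the next term,
    which is central; any non-central element of it will do. *)
Lemma nonabelian_second_center : nonabelian Q -> nilpotent_group Q ->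
  exists x, gcentral2 x /\ ~ gcentral x.
Proof.
move=> [a [b nab]] [n nil].
have : forall x, lcs n x -> gcentral x by move=> x /nil ->; exact: gcentral1.
elim: n {nil} => [cen|n IH cen]; first by case: nab; apply: cen.
have [h|h] := pselect (forall x, lcs n x -> gcentral x); first exact: IH.
have [x /not_implyP [lx ncx]] := (existsNP _).2 h.
exists x; split=> // g; apply: cen; apply: gen_in.
by exists x, g; rewrite gcommD.
Qed.

(* Replacing y by y * th y pushes the defect y^-1 * th y one step down the lower central series. *)
Lemma involutive_eigenelement (th : Q -> Q) (S C : Q -> Prop) :
  nilpotent_group Q -> group_hom th -> (forall g, th (th g) = g) ->
  (forall g h, S g -> S h -> S (gmul g h)) -> (forall g, S g -> S (ginv g)) ->
  (forall g, S g -> S (th g)) ->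
  (forall a b, S a -> S b -> C (gmul a b) -> C (gmul a (ginv b)) -> C a) ->
  (exists y, S y /\ ~ C y) ->
  exists y, [/\ S y, ~ C y & th y = y \/ th y = ginv y].
Proof.
move=> [n nil] thM thK SM SV Sth Ciso [y0 [Sy0 nCy0]].
have : exists y, [/\ S y, ~ C y & th y = ginv y \/ exists2 c, lcs n c & th y = gmul y c].
  elim: n {nil} => [|n [y [Sy nCy [e|[c lc e]]]]].
  - exists y0; split=> //; right.
    by exists (gmul (ginv y0) (th y0)) => //; rewrite gmulVKg.
  - by exists y; split=> //; left.
  (* The element [y (th y)^-1] is always inverted by [th]. If it lies in [C], isolation keeps
     [y (th y)] outside [C], and the defect of the latter is [[c, y]], one step deeper. *)
  have [h|h] := pselect (C (gmul y (ginv (th y)))).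
    exists (gmul y (th y)); split; first by apply: SM => //; apply: Sth.
      by move=> h'; apply: nCy; apply: (Ciso y (th y)) => //; apply: Sth.
    right; exists (lcomm c y); first by apply: gen_in; exists c, y; rewrite gcommD.
    by rewrite thM thK e gcommD; gsimp.
  exists (gmul y (ginv (th y))); split=> //; first by apply: SM => //; apply/SV/Sth.
  by left; rewrite thM ghomV // thK; gsimp.
move=> [y [Sy nCy [e|[c /nil -> e]]]]; exists y; split=> //; first by right.
by left; rewrite e gmulg1.
Qed.

(** [involutive_eigenelement] is applied twice: to the second center and the center for [x], then to
    the whole group and the centralizer of [x] for [y]. *)
Lemma nilpotent_heisenberg_pair (st : Q -> Q) : group_involution st ->
  nonabelian Q -> torsion_free Q -> nilpotent_group Q ->
  exists x y z : Q, [/\ gcentral z, z <> gone, gmul x y = gmul (gmul y x) z,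
    st x = x \/ st x = ginv x & st y = y \/ st y = ginv y].
Proof.
move=> [stM stK] nab tf nil.
pose th g := ginv (st g).
have st1 : st gone = gone.
  by apply: (@gmulI _ (st gone)); rewrite -stM !gmulg1.
have stV g : st (ginv g) = ginv (st g).
  by apply: (@gmulI _ (st g)); rewrite -stM gmulV st1 gmulgV.
have thM : group_hom th by move=> a b; rewrite /th stM ginvM.
have thK g : th (th g) = g by rewrite /th stV stK ginvK.
have thc z : gcentral z -> gcentral (th z).
  by move=> cz g; have /(congr1 th) := cz (th g); rewrite !thM thK.
have thR a b : th (lcomm a b) = lcomm (th a) (th b).
  by rewrite !gcommD !thM !(ghomV thM).
have c2M a b : gcentral2 a -> gcentral2 b -> gcentral2 (gmul a b).
  move=> ca cb g; have -> : lcomm (gmul a b) g = gmul (lcomm a g) (lcomm b g).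
    have e : gmul (gmul a b) g = gmul (gmul g (gmul a b)) (gmul (lcomm a g) (lcomm b g)).
      rewrite -gmulA (gcommE b g) !gmulA (gcommE a g) -!gmulA; congr gmul; congr gmul.
      by rewrite !gmulA (ca g b).
    by apply: (@gmulI _ (gmul g (gmul a b))); rewrite -gcommE e.
  exact: gcentralM.
have c2V a : gcentral2 a -> gcentral2 (ginv a).
  move=> ca g; have -> : lcomm (ginv a) g = ginv (lcomm a g).
    apply: (@gmulI _ (gmul g (ginv a))); rewrite -gcommE.
    apply: (@gmulI _ a); rewrite gmulVKg -!gmulA (gcentralV (ca g) (ginv a)).
    by rewrite (gmulA a g) (gcommE a g); gsimp.
  exact: gcentralV.
have c2th a : gcentral2 a -> gcentral2 (th a).
  by move=> ca g; rewrite -[g]thK -thR; apply: thc.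
have [x [cx ncx ex]] := involutive_eigenelement nil thM thK c2M c2V c2th
  (fun a b => @center_isolated a b tf) (nonabelian_second_center nab nil).
have [y0 ny0] : exists y, ~ gcommutes x y.
  by apply/existsNP => h; apply: ncx => g; symmetry; apply: h.
have [y [_ ncy ey]] : exists y, [/\ True, ~ gcommutes x y & th y = y \/ th y = ginv y].
  apply: (@involutive_eigenelement th (fun=> True) (gcommutes x)) => //; last by exists y0.
  by move=> a b _ _; apply: centralizer_isolated.
have st_of g : th g = g \/ th g = ginv g -> st g = g \/ st g = ginv g.
  by rewrite /th => -[e|e]; [right|left]; rewrite -[LHS]ginvK e ?ginvK.
exists x, y, (lcomm x y); split; [exact: cx| |exact: gcommE|exact: st_of|exact: st_of].
by move=> /gcomm_eq1.
Qed.

End NilpotentInvolution.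

(** * Division subrings, skew polynomials and their fractions *)

Section DivisionSubrings.
Variable D : unitRingType.
Hypothesis Ddiv : is_division_ring D.
Implicit Types (L : D -> Prop) (c d e f s t : D).

(** [dsrV] is unconditional because [0^-1] is [0] by convention. *)
Record division_subring L : Prop := DivisionSubring {
  dsr1 : L 1;
  dsrB : forall c d, L c -> L d -> L (c - d);
  dsrM : forall c d, L c -> L d -> L (c * d);
  dsrV : forall c, L c -> L c^-1 }.

Definition normalizes t L := forall c, L c -> L (t * c * t^-1) /\ L (t^-1 * c * t).

Definition lindep L (J : eqType) (e : J -> D) : Prop :=
  forall (s : seq J) (c : J -> D), uniq s -> (forall j, L (c j)) ->
    \sum_(j <- s) c j * e j = 0 -> forall j, j \in s -> c j = 0.

Lemma divring_mul_neq0 c d : c != 0 -> d != 0 -> c * d != 0.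
Proof. by move=> /Ddiv cu d0; apply: contra d0 => /eqP/(canRL (mulKr cu)); rewrite mulr0 => ->. Qed.

Section Closure.
Variable L : D -> Prop.
Hypothesis dL : division_subring L.

Lemma dsr0 : L 0.
Proof. by rewrite -(subrr 1); apply: dsrB => //; apply: dsr1. Qed.

Lemma dsrN c : L c -> L (- c).
Proof. by move=> Lc; rewrite -sub0r; apply: dsrB => //; apply: dsr0. Qed.

Lemma dsrD c d : L c -> L d -> L (c + d).
Proof. by move=> Lc Ld; rewrite -[d]opprK; apply: dsrB => //; apply: dsrN. Qed.

Lemma dsrX c n : L c -> L (c ^+ n).
Proof.
move=> Lc; elim: n => [|n IH]; first by rewrite expr0; apply: dsr1.
by rewrite exprS; apply: dsrM.
Qed.

Lemma dsr_sum (I : Type) (r : seq I) (P : pred I) (F : I -> D) :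
  (forall i, P i -> L (F i)) -> L (\sum_(i <- r | P i) F i).
Proof. by move=> LF; apply: (big_ind L) => //; [exact: dsr0 | exact: dsrD]. Qed.

End Closure.

Section SkewPolynomials.
Variables (L : D -> Prop) (t : D).
Hypotheses (dL : division_subring L) (t_neq0 : t != 0) (tL : normalizes t L).

Let t_unit : t \is a GRing.unit := Ddiv t_neq0.

(** Horner form of a left polynomial in [t] of degree less than [n]. As a predicate on elements of
    [D] it does not presuppose independent powers of [t]: [n] is only a bound, and coefficients need
    not be unique. *)
Fixpoint skewpol n d : Prop :=
  if n is n'.+1 then exists c d', [/\ L c, skewpol n' d' & d = c + d' * t]
  else d = 0.

Definition is_skewpol d := exists n, skewpol n d.

Lemma skewpol_widenS n d : skewpol n d -> skewpol n.+1 d.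
Proof.
elim: n d => [|n IH] d; first by move=> ->; exists 0, 0; rewrite mul0r addr0; split=> //; apply: dsr0.
by move=> [c [d' [Lc /IH pd' ->]]]; exists c, d'.
Qed.

Lemma skewpol_widen n m d : (n <= m)%N -> skewpol n d -> skewpol m d.
Proof.
by move=> /subnK <-; elim: (m - n)%N => [//|l IH] /IH; apply: skewpol_widenS.
Qed.

Lemma skewpolD n d e : skewpol n d -> skewpol n e -> skewpol n (d + e).
Proof.
elim: n d e => [|n IH] d e; first by move=> -> ->; rewrite addr0.
move=> [c [d' [Lc pd ->]]] [c' [e' [Lc' pe ->]]].
exists (c + c'), (d' + e'); rewrite mulrDl addrACA.
by split=> //; [exact: dsrD | exact: IH].
Qed.

Lemma skewpolZ n c d : L c -> skewpol n d -> skewpol n (c * d).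
Proof.
move=> Lc; elim: n d => [|n IH] d; first by move=> ->; rewrite mulr0.
move=> [c' [d' [Lc' pd ->]]]; exists (c * c'), (c * d'); rewrite mulrDr mulrA.
by split=> //; [exact: dsrM | exact: IH].
Qed.

Lemma skewpol_conj n d : skewpol n d -> skewpol n (t * d * t^-1).
Proof.
elim: n d => [|n IH] d; first by move=> ->; rewrite mulr0 mul0r.
move=> [c [d' [Lc pd ->]]]; exists (t * c * t^-1), (t * d' * t^-1).
split; [exact: (tL Lc).1 | exact: IH |].
by rewrite mulrDr mulrDl -!mulrA divrr // mulVr // mulr1.
Qed.

Lemma skewpol_conjV n d : skewpol n d -> skewpol n (t^-1 * d * t).
Proof.
elim: n d => [|n IH] d; first by move=> ->; rewrite mulr0 mul0r.
move=> [c [d' [Lc pd ->]]]; exists (t^-1 * c * t), (t^-1 * d' * t).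
split; [exact: (tL Lc).2 | exact: IH |].
by rewrite mulrDr mulrDl -!mulrA.
Qed.

Lemma skewpol_mulXr n d : skewpol n d -> skewpol n.+1 (d * t).
Proof. by move=> pd; exists 0, d; rewrite add0r; split=> //; apply: dsr0. Qed.

Lemma skewpol_mulX n d : skewpol n d -> skewpol n.+1 (t * d).
Proof. by move=> /skewpol_conj/skewpol_mulXr; rewrite mulrVK. Qed.

Lemma skewpol_mulXn n m d : skewpol n d -> skewpol (m + n) (t ^+ m * d).
Proof.
move=> pd; elim: m => [|m IH]; first by rewrite mul1r.
by rewrite exprS -mulrA; apply: skewpol_mulX.
Qed.

Lemma skewpol_lead n d : skewpol n.+1 d ->
  exists c d', [/\ L c, skewpol n d' & d = d' + c * t ^+ n].
Proof.
elim: n d => [|n IH] d [c [d' [Lc]]].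
  by move=> /= -> ->; exists c, 0; rewrite mul0r addr0 add0r mulr1.
move=> /IH [c1 [d1 [Lc1 pd1 ->]]] ->; exists c1, (c + d1 * t); split=> //.
  by exists c, d1.
by rewrite mulrDl -mulrA -exprSr addrA.
Qed.

Lemma skewpol_sum n d : skewpol n d ->
  exists2 c : nat -> D, forall i, L (c i) & d = \sum_(i < n) c i * t ^+ i.
Proof.
elim: n d => [|n IH] d.
  by move=> ->; exists (fun=> 0) => [_|]; [exact: dsr0 | rewrite big_ord0].
move=> [c [d' [Lc /IH [c' Lc' ->] ->]]]; exists (fun i => if i is i'.+1 then c' i' else c).
  by case.
rewrite big_ord_recl mulr1 mulr_suml; congr (_ + _); apply: eq_bigr => i _.
by rewrite -mulrA -exprSr.
Qed.

Lemma is_skewpolC c : L c -> is_skewpol c.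
Proof. by move=> Lc; exists 1%N, c, 0; rewrite mul0r addr0. Qed.

Lemma is_skewpol0 : is_skewpol 0.
Proof. by exists 0%N. Qed.

Lemma is_skewpol1 : is_skewpol 1.
Proof. exact/is_skewpolC/(dsr1 dL). Qed.

Lemma is_skewpolX : is_skewpol t.
Proof. by case: is_skewpol1 => n /skewpol_mulXr; rewrite mul1r => ?; exists n.+1. Qed.

Lemma is_skewpolD d e : is_skewpol d -> is_skewpol e -> is_skewpol (d + e).
Proof.
move=> [n pd] [m pe]; exists (maxn n m); apply: skewpolD.
  exact: skewpol_widen (leq_maxl _ _) pd.
exact: skewpol_widen (leq_maxr _ _) pe.
Qed.

Lemma is_skewpolN d : is_skewpol d -> is_skewpol (- d).
Proof.
by move=> [n pd]; exists n; rewrite -mulN1r; apply: skewpolZ => //; apply/(dsrN dL)/(dsr1 dL).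
Qed.

Lemma is_skewpolM d e : is_skewpol d -> is_skewpol e -> is_skewpol (d * e).
Proof.
move=> [n]; elim: n d e => [|n IH] d e; first by move=> -> _; rewrite mul0r; apply: is_skewpol0.
move=> [c [d' [Lc pd ->]]] [m pe]; rewrite mulrDl -mulrA; apply: is_skewpolD.
  by exists m; apply: skewpolZ.
by apply: IH => //; exists m.+1; apply: skewpol_mulX.
Qed.

Lemma skewpol_div n m f s c : (m <= n)%N -> skewpol n.+1 f -> skewpol m s ->
  L c -> c != 0 -> exists2 q, is_skewpol q & skewpol n (f - q * (s + c * t ^+ m)).
Proof.
move=> le_mn /skewpol_lead [b [f' [Lb pf ->]]] ps Lc /Ddiv cu.
(* This quotient [q] satisfies [q c t^m = b t^n], so the leading terms cancel. *)
exists (b * (t ^+ (n - m) * c^-1)).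
  apply: is_skewpolM; first exact: is_skewpolC.
  have [k] := is_skewpolC (dsrV dL Lc).
  by move=> /(skewpol_mulXn (n - m)) pc; exists (n - m + k)%N.
rewrite mulrDr -!mulrA mulKr // -exprD subnK // opprD addrACA subrr addr0.
apply: skewpolD => //; rewrite -mulN1r; apply: skewpolZ; first exact/(dsrN dL)/(dsr1 dL).
apply: skewpolZ => //; rewrite -[n in skewpol n](subnK le_mn); apply: skewpol_mulXn.
exact/skewpolZ/ps/(dsrV dL).
Qed.

(* By the subtractive Euclidean algorithm on degrees. *)
Lemma skewpol_ore f s : is_skewpol f -> is_skewpol s -> f != 0 -> s != 0 ->
  exists a b, [/\ is_skewpol a, is_skewpol b, a != 0, b != 0 & a * f = b * s].
Proof.
move=> [n pf] [m ps]; move: {2}(n + m)%N (leqnn (n + m)) => N.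
elim: N => [|N IH] in n m f s pf ps *.
  by rewrite leqn0 addn_eq0 => /andP[/eqP en _]; move: pf; rewrite en => ->; rewrite eqxx.
case: n pf => [->|n pf]; first by rewrite eqxx.
case: m ps => [->|m ps]; first by rewrite eqxx.
rewrite addSn addnS ltnS => leN f0 s0.
have [c [s' [Lc ps' es]]] := skewpol_lead ps.
have [b [f' [Lb pf' ef]]] := skewpol_lead pf.
(* Degree bounds need not be attained: a vanishing top coefficient merely lowers the bound. *)
have [c0|c0] := eqVneq c 0.
  move: es; rewrite c0 mul0r addr0 => es; rewrite -es in ps'.
  by apply: (IH n.+1 m) => //; rewrite addSn.
have [b0|b0] := eqVneq b 0.
  move: ef; rewrite b0 mul0r addr0 => ef; rewrite -ef in pf'.
  by apply: (IH n m.+1) => //; rewrite addnS.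
have [le_mn|/ltnW le_nm] := leqP m n.
  have [q pq] := skewpol_div le_mn pf ps' Lc c0; rewrite -es => pr.
  have [r0|r0] := eqVneq (f - q * s) 0.
    have efq : f = q * s by apply/eqP; rewrite -subr_eq0 r0.
    exists 1, q; rewrite mul1r oner_neq0; split=> //; first exact: is_skewpol1.
    by apply: contra f0 => /eqP q0; rewrite efq q0 mul0r.
  have [|a [d [pa pd a0 d0 e]]] := IH n m.+1 (f - q * s) s pr ps _ r0 s0; first by rewrite addnS.
  have e' : a * f = (a * q + d) * s by rewrite mulrDl -mulrA -e mulrBr addrC subrK.
  exists a, (a * q + d); split=> //; first by apply: is_skewpolD => //; apply: is_skewpolM.
  by apply: contraTneq (divring_mul_neq0 a0 f0) => z; rewrite e' z mul0r eqxx.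
have [q pq] := skewpol_div le_nm ps pf' Lb b0; rewrite -ef => pr.
have [r0|r0] := eqVneq (s - q * f) 0.
  have esq : s = q * f by apply/eqP; rewrite -subr_eq0 r0.
  exists q, 1; rewrite mul1r oner_neq0; split=> //; first exact: is_skewpol1.
  by apply: contra s0 => /eqP q0; rewrite esq q0 mul0r.
have [|a [d [pa pd a0 d0 e]]] := IH n.+1 m f (s - q * f) pf pr _ f0 r0; first by rewrite addSn.
have e' : (a + d * q) * f = d * s by rewrite mulrDl e mulrBr -mulrA subrK.
exists (a + d * q), d; split=> //; first by apply: is_skewpolD => //; apply: is_skewpolM.
by apply: contraTneq (divring_mul_neq0 d0 s0) => z; rewrite -e' z mul0r eqxx.
Qed.

(** Left fractions [s^-1 f], described inside [D] by clearing the denominator. *)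
Definition skewfrac d :=
  exists s f, [/\ is_skewpol s, is_skewpol f, s != 0 & s * d = f].

Lemma skewfrac_pol d : is_skewpol d -> skewfrac d.
Proof. by move=> pd; exists 1, d; rewrite mul1r oner_neq0; split=> //; apply: is_skewpol1. Qed.

Lemma skewfracC c : L c -> skewfrac c.
Proof. by move=> /is_skewpolC/skewfrac_pol. Qed.

Lemma skewfracX : skewfrac t.
Proof. exact/skewfrac_pol/is_skewpolX. Qed.

(** The Ore condition supplies [a s = b s'], a common denominator for differences, and [a f = b s'],
    which turns [s^-1 f s'^-1 f'] into [(a s)^-1 b f']. *)
Lemma skewfrac_dsr : division_subring skewfrac.
Proof.
split.
- exact/skewfrac_pol/is_skewpol1.
- move=> c d [s [f [ps pf s0 e]]] [s' [f' [ps' pf' s'0 e']]].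
  have [a [b [pa pb a0 b0 eab]]] := skewpol_ore ps ps' s0 s'0.
  exists (a * s), (a * f - b * f'); split; last by rewrite mulrBr -e -e' [in LHS]eab !mulrA eab.
  + exact: is_skewpolM.
  + by apply: is_skewpolD; [|apply: is_skewpolN]; apply: is_skewpolM.
  + exact: divring_mul_neq0.
- move=> c d [s [f [ps pf s0 e]]] [s' [f' [ps' pf' s'0 e']]].
  have [f0|f0] := eqVneq f 0.
    have -> : c * d = 0 by rewrite -[c](mulKr (Ddiv s0)) e f0 mulr0 mul0r.
    exact/skewfrac_pol/is_skewpol0.
  have [a [b [pa pb a0 b0 eab]]] := skewpol_ore pf ps' f0 s'0.
  exists (a * s), (b * f'); split; try exact: is_skewpolM; first exact: divring_mul_neq0.
  by rewrite mulrA -(mulrA a) e eab -mulrA e'.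
- move=> d fd; have [->|d0] := eqVneq d 0; first by rewrite invr0; apply/skewfrac_pol/is_skewpol0.
  move: fd => [s [f [ps pf s0 e]]]; exists f, s; split=> //.
    by rewrite -e; apply: divring_mul_neq0.
  by rewrite -e mulrK //; apply: Ddiv.
Qed.

Lemma skewfrac_min L' : division_subring L' -> (forall c, L c -> L' c) -> L' t ->
  forall d, skewfrac d -> L' d.
Proof.
move=> dL' LL' L't d [s [f [[n ps] [m pf] s0 e]]].
have pL k h : skewpol k h -> L' h.
  elim: k h => [|k IH] h; first by move=> ->; apply: dsr0.
  move=> [c [h' [Lc /IH Lh ->]]].
  by apply: dsrD => //; [exact: LL' | exact: dsrM].
rewrite -[d](mulKr (Ddiv s0)) e; apply: (dsrM dL'); last exact: pL pf.
exact/(dsrV dL')/pL/ps.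
Qed.

Lemma skewfrac_common_denominator (J : eqType) (r : seq J) (c : J -> D) :
  (forall j, skewfrac (c j)) ->
  exists q n, q != 0 /\ forall j, j \in r -> skewpol n (q * c j).
Proof.
move=> fc; suff [q [pq q0 h]] : exists q, [/\ is_skewpol q, q != 0 &
    forall j, j \in r -> is_skewpol (q * c j)].
  exists q; elim: r h => [|i r IH] h; first by exists 0%N.
  have [j jr|n [_ hn]] := IH; first by apply: h; rewrite inE jr orbT.
  have [m pm] := h i (mem_head _ _).
  exists (maxn n m); split=> // j; rewrite inE => /predU1P[->|/hn].
    exact: skewpol_widen (leq_maxr _ _) pm.
  exact/skewpol_widen/leq_maxl.
elim: r => [|i r [q [pq q0 h]]].
  by exists 1; rewrite oner_neq0; split=> //; apply: is_skewpol1.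
have [s [f [ps pf s0 e]]] := fc i.
have [a [b [pa pb a0 b0 eab]]] := skewpol_ore pq ps q0 s0.
exists (a * q); split; [exact: is_skewpolM | exact: divring_mul_neq0 |].
move=> j; rewrite inE => /predU1P[->|/h hj].
  by rewrite eab -mulrA e; apply: is_skewpolM.
by rewrite -mulrA; apply: is_skewpolM.
Qed.

(** Multiplying on the left by a common denominator makes the coefficients left polynomials, so a
    relation over fractions becomes one over [L] between the products [t^i e_j]. *)
Lemma skewfrac_lindep (J : eqType) (e : J -> D) :
  lindep L (fun p : nat * J => t ^+ p.1 * e p.2) -> lindep skewfrac e.
Proof.
move=> ind r c ur fc e0 j jr.
have [q [n [q0 h]]] := skewfrac_common_denominator r fc.
have [a ha] : exists a : J -> nat -> D, forall j, (forall i, L (a j i)) /\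
    (j \in r -> q * c j = \sum_(i < n) a j i * t ^+ i).
  suff /choice[a ha] : forall j, exists a : nat -> D, (forall i, L (a i)) /\
      (j \in r -> q * c j = \sum_(i < n) a i * t ^+ i) by exists a.
  move=> i; have [ir|ir] := boolP (i \in r); last first.
    by exists (fun=> 0); split=> // _; apply: dsr0.
  by have [a La ea] := skewpol_sum (h i ir); exists a.
pose s := [seq (i, j) | i <- iota 0 n, j <- r].
have us : uniq s by apply: allpairs_uniq => //; [exact: iota_uniq | move=> [? ?] [? ?]].
have a0 i : (i < n)%N -> a j i = 0.
  move=> lin; pose b (p : nat * J) := a p.2 p.1.
  apply: (ind s b us _ _ (i, j)) => [[? ?]||]; first exact: (ha _).1.
    transitivity (q * \sum_(j <- r) c j * e j); last by rewrite e0 mulr0.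
    rewrite big_allpairs_dep /= exchange_big mulr_sumr /= !big_seq.
    apply: eq_bigr => l lr; rewrite mulrA (ha l).2 // mulr_suml.
    rewrite -[n in iota 0 n]subn0 -/(index_iota 0 n) big_mkord.
    by apply: eq_bigr => ? _; rewrite mulrA.
  by apply/allpairsP; exists (i, j); rewrite /= mem_iota.
apply/eqP; apply: contraTT jr => cj0; apply/negP => jr.
have /eqP := divring_mul_neq0 q0 cj0; rewrite (ha j).2 //; apply.
by apply: big1 => i _; rewrite a0 ?mul0r.
Qed.

End SkewPolynomials.

(** The elements carried into the fractions by conjugation with [h] form a division subring
    containing [L] and [t], hence every fraction, by minimality. *)
Lemma normalizes_skewfrac L (t h : D) : division_subring L -> t != 0 -> normalizes t L ->
  h != 0 -> normalizes h L -> skewfrac L t (h * t * h^-1) ->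
  skewfrac L t (h^-1 * t * h) -> normalizes h (skewfrac L t).
Proof.
move=> dL t0 tL /Ddiv hu hL ht hVt; have dF := skewfrac_dsr dL t0 tL.
have conj_dsr g : g \is a GRing.unit -> division_subring (fun d => skewfrac L t (g * d * g^-1)).
  move=> gu; split.
  - by rewrite mulr1 divrr //; apply: dsr1 dF.
  - by move=> c d fc fd; rewrite mulrBr mulrBl; apply: dsrB.
  - move=> c d fc fd; have -> : g * (c * d) * g^-1 = (g * c * g^-1) * (g * d * g^-1).
      by rewrite !mulrA mulrVK.
    exact: dsrM.
  move=> c /(dsrV dF); have [->|/Ddiv cu] := eqVneq c 0.
    by rewrite !mulr0 mul0r !invr0 mulr0 mul0r.
  by rewrite invrM ?unitrMl ?unitrV // invrM // invrK mulrA.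
move=> c fc; split.
  apply: (skewfrac_min (conj_dsr h hu)) fc => //.
  by move=> d /hL[Ld _]; apply: skewfracC.
have := conj_dsr h^-1; rewrite invrK unitrV => /(_ hu) dh.
apply: (skewfrac_min dh) fc => //.
by move=> d /hL[_ Ld]; apply: skewfracC.
Qed.

End DivisionSubrings.

(** * The [t]-adic filtration *)

Section AdicFiltration.
Variables (D : unitRingType) (K : D -> Prop) (t : D).
Hypotheses (Ddiv : is_division_ring D) (dK : division_subring K).
Hypotheses (t_neq0 : t != 0) (tK : normalizes t K).
Hypothesis t_free : lindep K (fun i : nat => t ^+ i).
Implicit Types (c d e f s : D).

Local Notation pol := (is_skewpol K t).

Let t_unit : t \is a GRing.unit := Ddiv t_neq0.

Let polD d e : pol d -> pol e -> pol (d + e) := @is_skewpolD _ _ _ dK d e.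
Let polM d e : pol d -> pol e -> pol (d * e) :=
  @is_skewpolM _ Ddiv _ _ dK t_neq0 tK d e.

(** Independence of the powers of [t] makes constant terms well defined. *)
Lemma skewpol_const_eq0 c f : K c -> pol f -> c + f * t = 0 -> c = 0.
Proof.
move=> Kc [n pf] e.
have [b Kb eb] : exists2 b : nat -> D, forall i, K (b i) &
    c + f * t = c + \sum_(i < n) b i * t ^+ i.+1.
  have [b Kb ->] := skewpol_sum dK pf; exists b => //; congr (_ + _).
  by rewrite mulr_suml; apply: eq_bigr => i _; rewrite exprSr mulrA.
pose a i := if i is i'.+1 then b i' else c.
apply: (@t_free (iota 0 n.+1) a (iota_uniq _ _) _ _ 0%N) => //; first by case.
have <- : index_iota 0 n.+1 = iota 0 n.+1 by rewrite /index_iota subn0.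
by rewrite big_mkord big_ord_recl expr0 mulr1 -[RHS]e eb.
Qed.

Definition skewpol_unit s := exists c s', [/\ K c, c != 0, pol s' & s = c + s' * t].

Lemma skewpol_unit_pol s : skewpol_unit s -> pol s.
Proof.
move=> [c [s' [Kc _ ps ->]]]; apply: polD => //; first exact: is_skewpolC.
by apply: polM => //; apply: is_skewpolX.
Qed.

Lemma skewpol_unit1 : skewpol_unit 1.
Proof.
exists 1, 0; rewrite mul0r addr0 oner_neq0; split=> //; first exact: dsr1.
exact: is_skewpol0.
Qed.

Lemma skewpol_split f : pol f -> exists c f', [/\ K c, pol f' & f = c + f' * t].
Proof.
move=> [[->|n [c [f' [Kc pf ->]]]]]; last by exists c, f'; split=> //; exists n.
exists 0, 0; rewrite mul0r addr0; split=> //; [exact: dsr0 | exact: is_skewpol0].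
Qed.

Lemma skewpol_conjP f : pol f -> pol (t * f * t^-1).
Proof. by move=> [n pf]; exists n; apply: skewpol_conj. Qed.

Lemma skewpol_conjVP f : pol f -> pol (t^-1 * f * t).
Proof. by move=> [n pf]; exists n; apply: skewpol_conjV. Qed.

Lemma skewpol_mul_split c f c' f' :
  (c + f * t) * (c' + f' * t) =
  c * c' + (c * f' + f * (t * c' * t^-1) + f * (t * f' * t^-1) * t) * t.
Proof.
rewrite mulrDl !mulrDr -!mulrA -addrA; congr (_ + _).
rewrite !mulrDl -!mulrA !addrA mulVr // !mulr1; congr (_ + _ + _).
by rewrite (mulrA t^-1) mulVr // mul1r.
Qed.

Lemma skewpol_mul_split_pol c f c' f' : K c -> K c' -> pol f -> pol f' ->
  pol (c * f' + f * (t * c' * t^-1) + f * (t * f' * t^-1) * t).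
Proof.
move=> Kc Kc' pf pf'.
have pc' : pol (t * c' * t^-1) by apply/is_skewpolC/(tK Kc').1.
apply: polD => //; first apply: polD => //.
- by apply: polM => //; apply: is_skewpolC.
- exact: polM.
by apply: polM; [apply: polM => //; apply: skewpol_conjP | apply: is_skewpolX].
Qed.

Lemma skewpol_unitM s s' : skewpol_unit s -> skewpol_unit s' -> skewpol_unit (s * s').
Proof.
move=> [c [f [Kc c0 pf ->]]] [c' [f' [Kc' c'0 pf' ->]]].
rewrite skewpol_mul_split; eexists; eexists; split; last by [].
- exact: dsrM.
- exact: divring_mul_neq0.
exact: skewpol_mul_split_pol.
Qed.

Lemma skewpol_unit_neq0 s : skewpol_unit s -> s != 0.
Proof.
move=> [c [f [Kc c0 pf ->]]]; apply: contra c0 => /eqP e.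
by rewrite (skewpol_const_eq0 Kc pf e).
Qed.

Lemma skewpol_unit_conj s : skewpol_unit s -> skewpol_unit (t * s * t^-1).
Proof.
move=> [c [f [Kc c0 pf ->]]]; exists (t * c * t^-1), (t * f * t^-1); split.
- exact: (tK Kc).1.
- apply: divring_mul_neq0 => //; first exact: divring_mul_neq0.
  by rewrite invr_eq0.
- exact: skewpol_conjP.
by rewrite mulrDr mulrDl -!mulrA divrr // mulVr // mulr1.
Qed.

(** The Ore condition gives [a f = b s] with [a] nonzero. If [a] has zero constant term, so has [b],
    since that of [s] is nonzero; a factor [t] then cancels and the degree bound of [a] drops. *)
Lemma skewpol_unit_ore f s : pol f -> skewpol_unit s ->
  exists a b, [/\ skewpol_unit a, pol b & a * f = b * s].
Proof.
move=> pf us; have [->|f0] := eqVneq f 0.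
  exists 1, 0; rewrite mulr0 mul0r; split=> //; [exact: skewpol_unit1 | exact: is_skewpol0].
have [a [b [[n pa] pb a0 b0 e]]] :=
  skewpol_ore Ddiv dK t_neq0 tK pf (skewpol_unit_pol us) f0 (skewpol_unit_neq0 us).
elim: n a b pa pb a0 {b0} e => [|n IH] a b; first by move=> -> _; rewrite eqxx.
move=> [c [a' [Kc pa' ea]]] pb a0 e.
have [c0|c0] := eqVneq c 0; last first.
  by exists a, b; split=> //; exists c, a'; split=> //; exists n.
have ea' : a = a' * t by rewrite ea c0 add0r.
have [cb [b' [Kcb pb' eb]]] := skewpol_split pb.
have us' := us; move: us' => [cs [s' [Kcs cs0 ps' es]]].
have cb0 : cb = 0.
  move: e; rewrite eb es skewpol_mul_split => e.
  have : cb * cs = 0.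
    apply: (@skewpol_const_eq0 _ (cb * s' + b' * (t * cs * t^-1) +
       b' * (t * s' * t^-1) * t - a' * (t * f * t^-1))).
    - exact: dsrM.
    - apply: polD => //; first exact: skewpol_mul_split_pol.
      apply: is_skewpolN => //; apply: polM => //; first by exists n.
      exact: skewpol_conjP.
    by rewrite mulrBl addrA -e -!mulrA mulVr // mulr1 ea' -mulrA subrr.
  by move=> /eqP; apply: contraTeq => cb0; apply: divring_mul_neq0.
have eb' : b = b' * t by rewrite eb cb0 add0r.
(* In [a' t f = b' t s] the factor [t] must be moved to the far left before it cancels, whence the
   conjugates. *)
apply: (IH (t^-1 * a' * t) (t^-1 * b' * t)).
- exact: skewpol_conjV.
- exact: skewpol_conjVP.
- by apply: contra a0 => /eqP/(congr1 (fun x => t * x)); rewrite mulr0 !mulrA divrr // mul1r -ea' => ->.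
by rewrite -!mulrA (mulrA a') -ea' (mulrA b') -eb' e.
Qed.

(** The [n]-th step of the filtration of the local ring at [t]: fractions [s^-1 f t^n]. *)
Definition adic n d := exists s f, [/\ skewpol_unit s, pol f & s * d = f * t ^+ n].

Lemma adic_pol n f : pol f -> adic n (f * t ^+ n).
Proof. by move=> pf; exists 1, f; rewrite mul1r; split=> //; apply: skewpol_unit1. Qed.

Lemma adic_conj n d : adic n d -> adic n (t * d * t^-1).
Proof.
move=> [s [f [us pf e]]]; exists (t * s * t^-1), (t * f * t^-1); split.
- exact: skewpol_unit_conj.
- exact: skewpol_conjP.
rewrite !mulrA mulrVK // -(mulrA t s) e -!mulrA; congr (_ * (_ * _)).
by apply: (mulIr t_unit); rewrite mulrVK // -mulrA -exprSr exprS mulKr.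
Qed.

Lemma adic_conjX n m d : adic n d -> exists2 d', adic n d' & t ^+ m * d = d' * t ^+ m.
Proof.
move=> Vd; elim: m => [|m [d' Vd' e]]; first by exists d; rewrite ?mul1r ?mulr1.
exists (t * d' * t^-1); first exact: adic_conj.
by rewrite exprS -mulrA e !mulrA mulrVK.
Qed.

Lemma adicD n d d' : adic n d -> adic n d' -> adic n (d + d').
Proof.
move=> [s [f [us pf e]]] [s' [f' [us' pf' e']]].
have [a [b [ua pb eab]]] := skewpol_unit_ore (skewpol_unit_pol us) us'.
exists (a * s), (a * f + b * f'); split.
- exact: skewpol_unitM.
- by apply: polD => //; apply: polM => //; apply: skewpol_unit_pol.
by rewrite mulrDr mulrDl -!mulrA -e -e' (mulrA b) -eab -!mulrA.
Qed.

Lemma adicN n d : adic n d -> adic n (- d).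
Proof.
move=> [s [f [us pf e]]]; exists s, (- f); rewrite mulrN e mulNr.
by split=> //; apply: is_skewpolN.
Qed.

Lemma adicB n d d' : adic n d -> adic n d' -> adic n (d - d').
Proof. by move=> Vd /adicN; apply: adicD. Qed.

Lemma adicM n m d d' : adic n d -> adic m d' -> adic (n + m) (d * d').
Proof.
move=> [s [f [us pf e]]] /(adic_conjX n) [c [s' [f' [us' pf' e']]] ec].
have [a [b [ua pb eab]]] := skewpol_unit_ore pf us'.
exists (a * s), (b * f'); split; [exact: skewpol_unitM | exact: polM |].
by rewrite -!mulrA (mulrA s) e -mulrA ec !mulrA eab -!mulrA (mulrA s') e' -!mulrA -exprD addnC.
Qed.

Lemma adic_weaken n m d : (m <= n)%N -> adic n d -> adic m d.
Proof.
move=> le_mn [s [f [us pf e]]]; exists s, (f * t ^+ (n - m)).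
rewrite -mulrA -exprD subnK //; split=> //; apply: polM => //.
have [k] := is_skewpol1 t dK; move=> /(skewpol_mulXn Ddiv dK t_neq0 tK (n - m)).
by rewrite mulr1; exists (n - m + k)%N.
Qed.

(** If [s d = f t], then [s (1 + d)] has the same nonzero constant term as [s], so it is again an
    admissible denominator. *)
Lemma adic_unit d : adic 1 d -> 1 + d != 0 /\ adic 0 (1 + d)^-1.
Proof.
move=> [s [f [us pf e]]].
have us' : skewpol_unit (s * (1 + d)).
  move: us => [c [s' [Kc c0 ps' es]]]; rewrite mulrDr mulr1 e expr1 es -addrA -mulrDl.
  by exists c, (s' + f); split=> //; apply: polD.
have d0 : 1 + d != 0.
  by apply: contra (skewpol_unit_neq0 us') => /eqP ->; rewrite mulr0.
split=> //; exists (s * (1 + d)), s; split=> //; first exact: skewpol_unit_pol.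
by rewrite mulrK ?mulr1 //; apply: Ddiv.
Qed.

(** By induction on [n]: comparing constant terms kills [c 0], after which a factor [t] cancels on
    the right. *)
Lemma adic_coef0 n m (c : nat -> D) : (forall i, K (c i)) ->
  adic n (\sum_(i < m) c i * t ^+ i) -> forall i, (i < n)%N -> (i < m)%N -> c i = 0.
Proof.
elim: n m c => [//|n IH] [//|m] c Kc.
rewrite big_ord_recl mulr1.
under eq_bigr do rewrite exprSr mulrA; rewrite -mulr_suml /=.
set r := \sum_(i < m) _ => -[s [f [[cs [s' [Kcs cs0 ps es]]] pf e]]].
have pr : pol r.
  rewrite /r; apply: (big_ind pol); [exact: is_skewpol0 | exact: polD |].
  move=> i _; apply: polM => //; first exact: is_skewpolC.
  have [k] := is_skewpol1 t dK; move=> /(skewpol_mulXn Ddiv dK t_neq0 tK i).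
  by rewrite mulr1; exists (i + k)%N.
have pfn : pol (f * t ^+ n).
  apply: polM => //.
  have [k] := is_skewpol1 t dK; move=> /(skewpol_mulXn Ddiv dK t_neq0 tK n).
  by rewrite mulr1; exists (n + k)%N.
have c0 : c 0%N = 0.
  have : cs * c 0%N = 0.
    apply: (@skewpol_const_eq0 _ (cs * r + s' * (t * c 0%N * t^-1) +
       s' * (t * r * t^-1) * t - f * t ^+ n)).
    - exact: dsrM.
    - apply: polD => //; first exact: skewpol_mul_split_pol.
      exact: is_skewpolN.
    by rewrite mulrBl addrA -skewpol_mul_split -es e -mulrA -exprSr subrr.
  by move=> /eqP; apply: contraTeq => c00; apply: divring_mul_neq0.
case=> [//|i] lin lim; apply: (IH m (fun i => c i.+1)) => //.
exists s, f; split=> //; first by exists cs, s'.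
apply: (mulIr t_unit); rewrite -!mulrA -exprSr -e c0 add0r; congr (_ * (_ * _)).
Qed.

End AdicFiltration.

(** * Products of rank one matrices along reduced words *)

Section RankOnePingPong.
Variable k : fieldType.
Hypothesis k2 : (2%:R : k) != 0.

(* The lines spanned by the images of 1 + y, 1 - y, 1 - x and 1 + x, where
   x = diag (1, -1) and y exchanges the two basis vectors. *)
Definition letter_vec (l : bool * bool) : 'cV[k]_2 :=
  \col_i (if l.1 then (if l.2 || (i == 0) then 1 else -1)
          else (l.2 == (i != 0))%:R).

Definition letter_mx l : 'M[k]_2 := letter_vec l *m (letter_vec l)^T.

(** Only mutually inverse letters have orthogonal vectors; [(1, 1)] and [(1, -1)] pair with
    themselves to 2, whence [k2]. *)
Lemma letter_dot_neq0 l l' : ~~ ((l.1 == l'.1) && (l.2 != l'.2)) ->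
  ((letter_vec l)^T *m letter_vec l') 0 0 != 0.
Proof.
move: l l' => [[] []] [[] []] //= _; rewrite !mxE !big_ord_recl big_ord0 !mxE /=;
  by rewrite ?(mulr1, mul1r, mulr0, mul0r, addr0, add0r, mulrNN, oppr_eq0, oner_eq0).
Qed.

Lemma letter_vec_neq0 l : letter_vec l != 0.
Proof.
apply/eqP => e; have := @letter_dot_neq0 l l.
by rewrite !eqxx /= e mulmx0 mxE eqxx => /(_ isT).
Qed.

(** Each inner factor [v_l^T v_l'] is a nonzero scalar, so the product collapses to the first column
    vector times a row. *)
Lemma reduced_prod_rank1 (M : bool * bool -> 'M[k]_2) (c : bool * bool -> k) l w :
  (forall l, c l != 0) -> (forall l, M l = c l *: letter_mx l) ->
  reduced_word (l :: w) ->
  exists a (q : 'rV_2), [/\ a != 0, q != 0 &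
    \prod_(l' <- l :: w) M l' = a *: (letter_vec l *m q)].
Proof.
move=> c0 eM; elim: w l => [|l' w IH] l.
  move=> _; exists (c l), (letter_vec l)^T; rewrite big_seq1 eM; split=> //.
  by rewrite trmx_eq0 letter_vec_neq0.
move=> red; have /andP[h /IH [a [q [a0 q0 e]]]] :
    ~~ ((l.1 == l'.1) && (l.2 != l'.2)) && reduced_word (l' :: w).
  by case: l l' red => [? ?] [? ?].
exists (c l * a * ((letter_vec l)^T *m letter_vec l') 0 0), q; split=> //.
  by rewrite !mulf_neq0 // letter_dot_neq0.
rewrite big_cons e eM -[_ * _]/(_ *m _) -scalemxAl -scalemxAr scalerA -[RHS]scalerA.
congr (_ *: _); rewrite /letter_mx -!mulmxA (mulmxA _^T).
by rewrite {1}[_^T *m letter_vec l']mx11_scalar mul_scalar_mx -scalemxAr.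
Qed.

(** A scalar matrix of size 2 has rank 0 or 2, never 1. The case [b = 0] is included because it is
    the one met at inverse letters. *)
Lemma reduced_prod_not_scalar (M : bool * bool -> 'M[k]_2) (c : bool * bool -> k) w b :
  (forall l, c l != 0) -> (forall l, M l = c l *: letter_mx l) ->
  w != [::] -> reduced_word w -> \prod_(l <- w) M l != b%:M.
Proof.
move=> c0 eM; case: w => [//|l w] _ red.
have [a [q [a0 q0 ->]]] := reduced_prod_rank1 c0 eM red; apply/eqP => e.
have [b0|b0] := eqVneq b 0.
  have [i [j vij]] := matrix0Pn _ (letter_vec_neq0 l).
  have [i' [j' qij]] := matrix0Pn _ q0.
  have := congr1 (fun A : 'M_2 => A i j') e; rewrite b0 !mxE big_ord1 mul0rn => /eqP.
  apply/negP; rewrite !mulf_neq0 //; first by rewrite (ord1 j) in vij.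
  by rewrite (ord1 i') in qij.
have := mxrankM_maxl (letter_vec l) q; rewrite -(mxrank_scale_nz _ a0) e.
rewrite -[b]mulr1 -scale_scalar_mx mxrank_scale_nz // mxrank1 => le2.
by have := leq_trans le2 (rank_leq_col (letter_vec l)).
Qed.

End RankOnePingPong.

(** * Conversions between the two notions of list membership *)

Lemma mem_In (T : eqType) (s : seq T) x : x \in s -> List.In x s.
Proof.
by elim: s => [//|y s IH]; rewrite inE => /predU1P[->|/IH]; [left | right].
Qed.

Lemma In_mem (T : eqType) (s : seq T) x : List.In x s -> x \in s.
Proof.
elim: s => [//|y s IH] /= [->|/IH h]; first exact: mem_head.
by rewrite inE h orbT.
Qed.

Lemma uniq_NoDup (T : eqType) (s : seq T) : uniq s -> List.NoDup s.
Proof.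
elim: s => [|x s IH] /=; first by move=> _; exact: List.NoDup_nil.
by move=> /andP[xs /IH us]; apply: List.NoDup_cons => // /In_mem; apply/negP.
Qed.

(** * Embedded group algebras and the division subrings they generate *)

Section GroupAlgebra.
Variables (k : fieldType) (G : group) (D : unitAlgType k) (phi : G -> D).
Hypothesis phi_emb : group_algebra_embedding phi.

Lemma emb1 : phi gone = 1.
Proof. by case: phi_emb. Qed.

Lemma embM g h : phi (gmul g h) = phi g * phi h.
Proof. by case: phi_emb. Qed.

Lemma emb_unit g : phi g \is a GRing.unit.
Proof. by apply/unitrP; exists (phi (ginv g)); rewrite -!embM gmulV gmulgV emb1. Qed.

Lemma emb_neq0 g : phi g != 0.
Proof. by apply: contraTneq (emb_unit g) => ->; rewrite unitr0. Qed.

Lemma embV g : phi (ginv g) = (phi g)^-1.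
Proof. by apply: (mulIr (emb_unit g)); rewrite mulVr ?emb_unit // -embM gmulV emb1. Qed.

Lemma embJ g h : phi (gmul (gmul g h) (ginv g)) = phi g * phi h * (phi g)^-1.
Proof. by rewrite !embM embV. Qed.

Lemma embX g n : phi (gpow g n) = phi g ^+ n.
Proof. by elim: n => [|n IH]; [exact: emb1 | rewrite exprS -IH -embM]. Qed.

(** Since [k[G]] embeds, a relation in [D] is formal and survives the linear extension of any map
    [F] on [G]. The elements [g i] may repeat, so coefficients are first collected. *)
Lemma emb_linear_relation (V : lmodType k) (F : G -> V) (I : finType) (P : pred I)
    (c : I -> k) (g : I -> G) :
  \sum_(i | P i) c i *: phi (g i) = 0 -> \sum_(i | P i) c i *: F (g i) = 0.
Proof.
move=> e0; pose s : seq {classic G} := undup [seq (g i : {classic G}) | i <- enum P].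
pose C (h : {classic G}) := \sum_(i | P i && ((g i : {classic G}) == h)) c i.
have sumE (V' : lmodType k) (F' : G -> V') :
    \sum_(h <- s) C h *: F' h = \sum_(i | P i) c i *: F' (g i).
  have -> : \sum_(h <- s) C h *: F' h =
      \sum_(h <- s) \sum_(i | P i && ((g i : {classic G}) == h)) c i *: F' (g i).
    by apply: eq_bigr => h _; rewrite scaler_suml; apply: eq_bigr => i /andP[_ /eqP ->].
  rewrite (exchange_big_dep P) /=; last by move=> ? i _ /andP[].
  apply: eq_bigr => i Pi; rewrite Pi /=.
  rewrite big_mkcond (bigD1_seq (g i : {classic G})) ?undup_uniq //=; last first.
    by rewrite mem_undup; apply/mapP; exists i => //; rewrite mem_enum.
  by rewrite eqxx big1 ?addr0 // => h; rewrite eq_sym => /negPf ->.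
rewrite -sumE big_seq; apply: big1 => h hs; have [_ _ ind] := phi_emb.
have us : uniq s := undup_uniq _.
have := ind s C (uniq_NoDup us); rewrite (sumE _ phi) => /(_ e0 h (mem_In hs)) ->.
by rewrite scale0r.
Qed.

Lemma divsub_dsr (H : G -> Prop) : division_subring (divsub phi H).
Proof.
split.
- by have := ds_scal phi H 1; rewrite scale1r.
- by move=> c d hc hd; apply: ds_add => //; apply: ds_opp.
- by move=> c d; apply: ds_mul.
move=> c hc; have [->|c0] := eqVneq c 0; last exact: ds_inv.
by rewrite invr0; have := ds_scal phi H 0; rewrite scale0r.
Qed.

Lemma divsub_conj (H : G -> Prop) g : (forall h, H h -> H (gmul (gmul g h) (ginv g))) ->
  forall d, divsub phi H d -> divsub phi H (phi g * d * (phi g)^-1).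
Proof.
have gu := emb_unit g.
move=> gH d; elim=> [a|h hH|c e _ hc _ he|c _ hc|c e _ hc _ he|c _ hc c0].
- by rewrite -scalerAr mulr1 -scalerAl divrr //; apply: ds_scal.
- by rewrite -embJ; apply/ds_grp/gH.
- by rewrite mulrDr mulrDl; apply: ds_add.
- by rewrite mulrN mulNr; apply: ds_opp.
- have -> : phi g * (c * e) / phi g = (phi g * c / phi g) * (phi g * e / phi g).
    by rewrite !mulrA mulrVK.
  exact: ds_mul.
have [cu|cu] := boolP (c \is a GRing.unit).
  have -> : phi g * c^-1 / phi g = (phi g * c / phi g)^-1.
    by rewrite invrM ?unitrMl ?unitrV // invrM // invrK mulrA.
  apply: ds_inv => //; apply: contra c0 => /eqP e.
  by rewrite -(mulKr gu c) -(mulrVK gu (phi g * c)) e mul0r mulr0.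
by rewrite (invr_out cu).
Qed.

Lemma dsr_zpow (L : D -> Prop) g i : division_subring L -> L (phi g) -> L (phi (zpow g i)).
Proof.
move=> dL Lg; have Lp n : L (phi (gpow g n)) by rewrite embX; apply: dsrX.
by case: i => n; [exact: Lp | rewrite embV; apply/(dsrV dL)/Lp].
Qed.

End GroupAlgebra.

(** Each [g j] is an element of [N] times a transversal element, and the former is absorbed into the
    coefficient; thus any family in distinct cosets inherits independence. *)
Lemma transversal_lindep (k : fieldType) (G : group) (N : G -> Prop) (Q : group)
    (pi : G -> Q) (D : unitAlgType k) (phi : G -> D) (tr : Q -> G) :
  group_hom pi -> (forall g, pi g = gone <-> N g) -> group_algebra_embedding phi ->
  (forall a, pi (tr a) = a) ->
  (forall (s : seq Q) (d : Q -> D), List.NoDup s ->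
       (forall a, divsub phi N (d a)) ->
       \sum_(a <- s) d a * phi (tr a) = 0 -> forall a, List.In a s -> d a = 0) ->
  forall (J : eqType) (g : J -> G), injective (fun j => pi (g j)) ->
  lindep (divsub phi N) (fun j => phi (g j)).
Proof.
move=> pih piN emb trK ind J g ginj s c us Lc e0 j js.
pose n j := gmul (g j) (ginv (tr (pi (g j)))).
have Nn i : N (n i) by apply/piN; rewrite pih ghomV // trK gmulgV.
have eg i : phi (g i) = phi (n i) * phi (tr (pi (g i))).
  by rewrite -embM // /n -gmulA gmulV gmulg1.
(* A partial inverse of [j |-> pi (g j)], turning coefficients indexed by [J] into coefficients
   indexed by [Q], zero off the image. *)
have [r hr] : exists r : Q -> option J, forall a, if r a is Some i then pi (g i) = a
    else forall i, pi (g i) <> a.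
  suff /choice[r hr] : forall a, exists o : option J, if o is Some i then pi (g i) = a
    else forall i, pi (g i) <> a by exists r.
  move=> a; have [[i e]|h] := pselect (exists i, pi (g i) = a); first by exists (Some i).
  by exists None => i e; apply: h; exists i.
have rE i : r (pi (g i)) = Some i.
  by have := hr (pi (g i)); case: (r _) => [i' /ginj -> //|/(_ i)].
pose d a := if r a is Some i then c i * phi (n i) else 0.
have : d (pi (g j)) = 0.
  apply: (ind [seq pi (g i) | i <- s]) => [||| ].
  - elim: s us {e0 js} => [|i s IH] /=; first by move=> _; exact: List.NoDup_nil.
    move=> /andP[is_ /IH us]; apply: List.NoDup_cons => //.
    move=> /(@List.in_map_iff _ _ (fun i => pi (g i)) s) [i' [/ginj -> /In_mem]].
    exact/negP.
  - move=> a; rewrite /d; case: (r a) => [i|]; last by apply: dsr0; apply: divsub_dsr.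
    by apply: ds_mul => //; apply: ds_grp.
  - by rewrite big_map -[RHS]e0; apply: eq_bigr => i _; rewrite /d rE -mulrA -eg.
  apply/(@List.in_map_iff _ _ (fun i => pi (g i)) s); exists j; split=> //.
  exact: mem_In.
by rewrite /d rE => /(canRL (mulrK (emb_unit emb _))); rewrite mul0r.
Qed.

(** * Unit groups and the specializing matrices *)

Section UnitGroup.
Variable R : unitRingType.

Let U := {u : R | u \is a GRing.unit}.

Let umul (a b : U) : U :=
  exist _ (val a * val b) (etrans (unitrMl (val a) (valP b)) (valP a)).
Let uone : U := exist _ 1 (unitr1 R).
Let uinv (a : U) : U := exist _ (val a)^-1 (etrans (unitrV (val a)) (valP a)).

(** Units are packaged as a [group] so that the Heisenberg identities apply to matrices; the
    definition is transparent so that products and inverses compute. *)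
Definition unit_group : group.
Proof.
apply: (@Defs.Group U umul uone uinv) => [a b c|a|a]; apply: val_inj => /=.
- exact: mulrA.
- exact: mul1r.
- exact/mulVr/(valP a).
Defined.

End UnitGroup.

Section SpecialMatrices.
Variable k : fieldType.

Definition spec_x : 'M[k]_2 :=
  \matrix_(i, j) (if i == j then (if i == 0 then 1 else -1) else 0).
Definition spec_y : 'M[k]_2 := \matrix_(i, j) (i != j)%:R.

Lemma ord2P (i : 'I_2) : i = 0 \/ i = 1.
Proof. by case: i => [[|[|//]] h]; [left | right]; apply: val_inj. Qed.

Lemma spec_xx : spec_x * spec_x = 1.
Proof.
apply/matrixP => i j; rewrite !mxE !big_ord_recl big_ord0 !mxE.
by case: (ord2P i) => ->; case: (ord2P j) => -> /=;
  rewrite ?(mulr0, mul0r, mulr1, addr0, add0r, mulrNN).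
Qed.

Lemma spec_yy : spec_y * spec_y = 1.
Proof.
apply/matrixP => i j; rewrite !mxE !big_ord_recl big_ord0 !mxE.
by case: (ord2P i) => ->; case: (ord2P j) => -> /=;
  rewrite ?(mulr0, mul0r, mulr1, addr0, add0r, mulrNN).
Qed.

Lemma spec_xy : spec_x * spec_y = - (spec_y * spec_x).
Proof.
apply/matrixP => i j; rewrite !mxE !big_ord_recl !big_ord0 !mxE.
by case: (ord2P i) => ->; case: (ord2P j) => -> /=;
  rewrite ?(mulr0, mul0r, mulr1, mul1r, addr0, add0r, mulrNN, oppr0, opprK).
Qed.

Lemma self_inverse_unit (A : 'M[k]_2) : A * A = 1 -> A \is a GRing.unit.
Proof. by move=> e; apply/unitrP; exists A. Qed.

Definition ux : unit_group 'M[k]_2 := exist _ spec_x (self_inverse_unit spec_xx).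
Definition uy : unit_group 'M[k]_2 := exist _ spec_y (self_inverse_unit spec_yy).
Definition uz : unit_group 'M[k]_2 := exist _ (-1) (unitrN1 _).

Lemma ux_uz : gcommutes ux uz.
Proof. by apply: val_inj; rewrite /= mulrN1 mulN1r. Qed.

Lemma uy_uz : gcommutes uy uz.
Proof. by apply: val_inj; rewrite /= mulrN1 mulN1r. Qed.

Lemma ux_uy : gmul ux uy = gmul (gmul uy ux) uz.
Proof. by apply: val_inj; rewrite /= mulrN1 spec_xy. Qed.

End SpecialMatrices.

(** * Specialization of power series in [Y] to matrices *)

Section Specialization.
Variables (k : fieldType) (G : group) (N : G -> Prop) (Q : group) (pi : G -> Q).
Variables (D : unitAlgType k) (phi : G -> D) (tr : Q -> G).
Hypotheses (nN : normal_subgroup N) (pih : group_hom pi).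
Hypothesis piN : forall g, pi g = gone <-> N g.
Hypothesis tfQ : torsion_free Q.
Hypotheses (Ddiv : is_division_ring D) (emb : group_algebra_embedding phi).
Hypothesis trK : forall a, pi (tr a) = a.
Hypothesis tr_free : forall (s : seq Q) (d : Q -> D), List.NoDup s ->
  (forall a, divsub phi N (d a)) ->
  \sum_(a <- s) d a * phi (tr a) = 0 -> forall a, List.In a s -> d a = 0.
Variables (X Y Z : G).
Hypotheses (Zc : gcentral (pi Z)) (Z1 : pi Z <> gone).
Hypothesis XY : gmul (pi X) (pi Y) = gmul (gmul (pi Y) (pi X)) (pi Z).

Local Notation x := (pi X).
Local Notation y := (pi Y).
Local Notation z := (pi Z).
Local Notation t := (phi Y).
Local Notation nf := (heis_nf x y z).

Let piV g : pi (ginv g) = ginv (pi g) := ghomV pih g.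
Let xz : gcommutes x z := Zc x.
Let yz : gcommutes y z := Zc y.

(** A tower starting at [D_N] and adjoining [Z], then [X]; in this order each new element normalizes
    the previous stage. Its top [base] is the coefficient ring of the filtration. *)
Definition base0 := divsub phi N.
Definition base1 := skewfrac base0 (phi Z).
Definition base := skewfrac base1 (phi X).

Lemma base0_dsr : division_subring base0.
Proof. exact: divsub_dsr. Qed.

Lemma normalizes_base0 g : normalizes (phi g) base0.
Proof.
have [_ NJ] := nN; move=> c Lc; split.
  apply: divsub_conj Lc => // h /(NJ (ginv g)); by rewrite ginvK.
have := @divsub_conj _ _ _ _ emb N (ginv g); rewrite (embV emb) invrK; apply=> //.
by move=> h /(NJ g); rewrite ginvK.
Qed.

Lemma base0_N n : N n -> base0 (phi n).
Proof. exact: ds_grp. Qed.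

Lemma base1_dsr : division_subring base1.
Proof.
apply: skewfrac_dsr => //; [exact: base0_dsr | exact: emb_neq0 |].
exact: normalizes_base0.
Qed.

Lemma same_image_factor (L : D -> Prop) g h : division_subring L ->
  (forall n, N n -> L (phi n)) -> pi g = pi h -> L (phi h) -> L (phi g).
Proof.
move=> dL LN e Lh; have -> : g = gmul (gmul g (ginv h)) h by gsimp.
rewrite (embM emb); apply: (dsrM dL) => //; apply: LN; apply/piN.
by rewrite pih piV e gmulgV.
Qed.

Lemma base1_N n : N n -> base1 (phi n).
Proof. by move=> /base0_N; apply: skewfracC; exact: base0_dsr. Qed.

Lemma base1_Z : base1 (phi Z).
Proof. exact/skewfracX/base0_dsr. Qed.

Lemma normalizes_base1 g : normalizes (phi g) base1.
Proof.
have conjZ h : base1 (phi (gmul (gmul h Z) (ginv h))).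
  apply: (same_image_factor base1_dsr base1_N _ base1_Z).
  by rewrite !pih piV Zc -gmulA gmulgV gmulg1.
apply: normalizes_skewfrac => //; try exact: normalizes_base0; try exact: emb_neq0.
- exact: base0_dsr.
- by rewrite -(embJ emb); apply: conjZ.
by have := conjZ (ginv g); rewrite (embJ emb) (embV emb) invrK.
Qed.

Lemma base_dsr : division_subring base.
Proof.
apply: skewfrac_dsr => //; [exact: base1_dsr | exact: emb_neq0 |].
exact: normalizes_base1.
Qed.

Lemma base1_base c : base1 c -> base c.
Proof. by apply: skewfracC; exact: base1_dsr. Qed.

Lemma base_mem g i l : pi g = gmul (zpow x i) (zpow z l) -> base (phi g).
Proof.
move=> e; pose h := gmul (zpow X i) (zpow Z l).
apply: (@same_image_factor _ _ h base_dsr).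
- by move=> n /base1_N/base1_base.
- by rewrite e /h pih !(zpow_hom _ _ pih).
rewrite (embM emb); apply: (dsrM base_dsr).
  by apply: (dsr_zpow emb _ base_dsr); apply/skewfracX/base1_dsr.
by apply: (dsr_zpow emb _ base_dsr); apply/base1_base/base1_Z.
Qed.

Lemma base_scal (a : k) : base (a%:A).
Proof. apply/base1_base; apply: skewfracC; [exact: base0_dsr | exact: ds_scal]. Qed.

(** Modulo [N], conjugation by [Y] sends [X] to [X Z^-1], and the inverse conjugation sends [X] to
    [X Z]. *)
Lemma normalizes_base : normalizes t base.
Proof.
apply: normalizes_skewfrac => //; try exact: normalizes_base1; try exact: emb_neq0.
- exact: base1_dsr.
- rewrite -(embJ emb); apply: (@base_mem _ 1 (-1)).
  rewrite !pih piV zpow1 zpowV; apply: (@gmulIg _ y).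
  rewrite -!gmulA gmulV gmulg1 -(gcommutesV yz) (gmulA x) XY -!gmulA.
  by rewrite gmulgV gmulg1.
rewrite -(embV emb) -!(embM emb); apply: (@base_mem _ 1 1).
rewrite !pih piV !zpow1; apply: (@gmulI _ y).
by rewrite -!gmulA gmulVKg XY gmulA.
Qed.

(** Descending the tower leaves the independence over [D_N] of the elements [Z^a X^b Y^c], which lie
    in distinct cosets of [N] by uniqueness of normal forms. *)
Lemma t_lindep : lindep base (fun i : nat => t ^+ i).
Proof.
apply: (skewfrac_lindep Ddiv base1_dsr (emb_neq0 emb X) (normalizes_base1 X)).
apply: (skewfrac_lindep Ddiv base0_dsr (emb_neq0 emb Z) (normalizes_base0 Z)).
pose g (p : nat * (nat * nat)) := gmul (gpow Z p.1) (gmul (gpow X p.2.1) (gpow Y p.2.2)).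
have ginj : injective (fun p => pi (g p)).
  have gE p : pi (g p) = nf (Posz p.2.1) (Posz p.1) (Posz p.2.2).
    rewrite /g !pih /heis_nf gmulA [in RHS]gmulA; congr gmul; last exact: (zpow_hom Y p.2.2).
    rewrite (zpow_hom Z p.1 pih) (zpow_hom X p.2.1 pih).
    symmetry; apply: gcommutes_zpow; exact: Zc.
  move=> [a [b c]] [a' [b' c']]; rewrite !gE => /(heis_nf_inj xz yz XY tfQ Z1) /=.
  by case=> -[->] [->] [->].
have := transversal_lindep pih piN emb trK tr_free ginj.
move=> h s c us Lc e0; apply: h => //; rewrite -[RHS]e0.
by apply: eq_bigr => p _; rewrite /g !(embM emb) !(embX emb).
Qed.

Local Notation adicK := (adic base t).

Let baseD := base_dsr.
Let t0 : t != 0 := emb_neq0 emb Y.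

Let baseK_free : lindep base (fun i : nat => t ^+ i) := t_lindep.
Let adD n d d' : adicK n d -> adicK n d' -> adicK n (d + d') :=
  @adicD _ _ _ Ddiv baseD t0 normalizes_base baseK_free n d d'.
Let adB n d d' : adicK n d -> adicK n d' -> adicK n (d - d') :=
  @adicB _ _ _ Ddiv baseD t0 normalizes_base baseK_free n d d'.
Let adM n m d d' : adicK n d -> adicK m d' -> adicK (n + m) (d * d') :=
  @adicM _ _ _ Ddiv baseD t0 normalizes_base baseK_free n m d d'.

(** The scalar ['X^j] is left out of [A]; [spec_pol] restores it from [j]. The degree [j] is natural
    because expansions are power series in [Y], while [i] and [l] may be negative. *)
Definition special (g : G) (j : nat) (A : 'M[k]_2) : Prop :=
  exists i l, pi g = nf i l (Posz j) /\ A = sval (heis_nf (ux k) (uy k) (uz k) i l (Posz j)).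

Lemma specialM g j A g' j' A' :
  special g j A -> special g' j' A' -> special (gmul g g') (j + j') (A * A').
Proof.
move=> [i [l [e ->]]] [i' [l' [e' ->]]]; exists (i + i'), (l + l' - i' * j%:Z).
split; first by rewrite pih e e' (heis_nfM xz yz XY) PoszD.
rewrite PoszD -(heis_nfM (ux_uz k) (uy_uz k) (ux_uy k)).
by [].
Qed.

Lemma special_inj g j A j' A' : special g j A -> special g j' A' -> j = j' /\ A = A'.
Proof.
move=> [i [l [e ->]]] [i' [l' [e' ->]]]; move: e'; rewrite e.
by move=> /(heis_nf_inj xz yz XY tfQ Z1)[<- <- [<-]].
Qed.

Lemma special1 g : pi g = gone -> special g 0 1.
Proof.
move=> e; exists 0, 0; split; first by rewrite e /heis_nf /= !gmul1.
by rewrite /= !mulr1.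
Qed.

(** [spec_x] is its own inverse, so both images give the same value. *)
Lemma special_x g : pi g = x \/ pi g = ginv x -> special g 0 (spec_x k).
Proof.
move=> [e|e]; [exists 1, 0 | exists (-1), 0]; (split; first by rewrite e /heis_nf /= !gmulg1);
  rewrite /= !mulr1 //.
by apply: (mulIr (self_inverse_unit (spec_xx k))); rewrite mulVr ?spec_xx // self_inverse_unit ?spec_xx.
Qed.

Lemma special_y g : pi g = y -> special g 1 (spec_y k).
Proof.
move=> e; exists 0, 0; split; first by rewrite e /heis_nf /= !gmul1 gmulg1.
by rewrite /= !mulr1 !mul1r.
Qed.

Lemma special_factor g j A : special g j A -> base (phi g * t ^- j).
Proof.
move=> [i [l [e _]]]; rewrite -(embX emb) -(embV emb) -(embM emb).
apply: (@base_mem _ i l); rewrite pih piV e.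
have -> : pi (gpow Y j) = zpow y (Posz j) := zpow_hom Y (Posz j) pih.
by rewrite /heis_nf -!gmulA gmulgV gmulg1.
Qed.

(* spec_pol m e W: e is the image in D of an element of k[G] supported in degree at
   least m in Y, and W is the value at x, y of that element of k[G]. *)
Inductive spec_pol (m : nat) : D -> 'M[{poly k}]_2 -> Prop :=
  | SpecPol0 : spec_pol m 0 0
  | SpecPolCons c g j A e W : special g j A -> (m <= j)%N -> spec_pol m e W ->
      spec_pol m (c *: phi g + e) ((c *: 'X^j) *: map_mx polyC A + W).

Lemma spec_polD m e W e' W' : spec_pol m e W -> spec_pol m e' W' ->
  spec_pol m (e + e') (W + W').
Proof.
move=> P P'; elim: P => [|c g j A {}e {}W sg mj _ IH]; first by rewrite !add0r.
by rewrite -!addrA; apply: SpecPolCons.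
Qed.

Lemma spec_pol1 m c g j A : special g j A -> (m <= j)%N ->
  spec_pol m (c *: phi g) ((c *: 'X^j) *: map_mx polyC A).
Proof.
move=> sg mj; have := SpecPolCons c sg mj (SpecPol0 m).
by rewrite !addr0.
Qed.

Lemma spec_polM m m' e W e' W' : spec_pol m e W -> spec_pol m' e' W' ->
  spec_pol (m + m') (e * e') (W * W').
Proof.
move=> P P'; elim: P => [|c g j A {}e {}W sg mj _ IH]; first by rewrite !mul0r; apply: SpecPol0.
rewrite !mulrDl; apply: spec_polD => // {IH}.
elim: P' => [|c' g' j' A' {}e' {}W' sg' mj' _ IH']; first by rewrite !mulr0; apply: SpecPol0.
rewrite !mulrDr; apply: spec_polD => //.
have -> : (c *: phi g) * (c' *: phi g') = (c * c') *: phi (gmul g g').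
  by rewrite (embM emb) -scalerAl -scalerAr scalerA.
have -> : (c *: 'X^j) *: map_mx polyC A * ((c' *: 'X^j') *: map_mx polyC A') =
    ((c * c') *: 'X^(j + j')) *: map_mx polyC (A * A').
  rewrite -scalerAl -scalerAr scalerA; congr (_ *: _); last by rewrite [RHS]map_mxM.
  by rewrite -scalerAl -scalerAr scalerA exprD.
by apply: spec_pol1; [exact: specialM | exact: leq_add].
Qed.

Lemma spec_pol_scal (a : k) : spec_pol 0 a%:A a%:P%:M.
Proof.
have := spec_pol1 (m := 0) a (special1 (ghom1 pih)) (leq0n 0).
by rewrite (emb1 emb) expr0 alg_polyC [map_mx _ _]map_mx1 scalemx1.
Qed.

Lemma spec_polX m e W n : spec_pol m e W -> spec_pol (n * m) (e ^+ n) (W ^+ n).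
Proof.
move=> P; elim: n => [|n IH]; first by have := spec_pol_scal 1; rewrite scale1r.
by rewrite !exprS mulSn; apply: spec_polM.
Qed.

Lemma spec_polN m e W : spec_pol m e W -> spec_pol m (- e) (- W).
Proof.
move=> P; have := spec_polM (spec_pol_scal (-1)) P.
by rewrite scaleN1r mulN1r polyCN raddfN /= mulNr mul1r.
Qed.

Lemma spec_pol_weaken m n e W : (n <= m)%N -> spec_pol m e W -> spec_pol n e W.
Proof.
move=> nm; elim=> [|c g j A {}e {}W sg mj _ IH]; first exact: SpecPol0.
by apply: SpecPolCons => //; apply: leq_trans mj.
Qed.

Lemma spec_pol_adic m e W : spec_pol m e W -> adicK m e.
Proof.
have ad0 n : adicK n 0.
  by have := adic_pol baseD n (is_skewpol0 base t); rewrite mul0r.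
elim=> [//|c g j A {}e {}W sg mj _ IH]; apply: adD => //.
apply: (adic_weaken Ddiv baseD t0 normalizes_base mj).
have -> : c *: phi g = (c%:A * (phi g * t ^- j)) * t ^+ j.
  rewrite mulrA mulrVK; first by rewrite -scalerAl mul1r.
  by rewrite unitrX // (emb_unit emb).
apply: (adic_pol baseD); apply: is_skewpolC.
by apply: (dsrM baseD); [exact: base_scal | exact: special_factor sg].
Qed.

Definition eqmodX n (A B : 'M[{poly k}]_2) := exists C, A = B + 'X^n *: C.

Lemma spec_pol_eqmod m e W : spec_pol m e W -> eqmodX m W 0.
Proof.
elim=> [|c g j A {}e {}W sg mj _ [C ->]]; first by exists 0; rewrite scaler0 addr0.
exists ((c *: 'X^(j - m)) *: map_mx polyC A + C).
by rewrite !add0r scalerDr scalerA -scalerAr -exprD subnKC.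
Qed.

(** Grouped by degree in [Y], the terms below degree [n] cancel by uniqueness of coefficients. Each
    cancellation is a relation in [k[G]], so the matrices cancel as well. *)
Lemma spec_pol_adic_eqmod n e W : spec_pol 0 e W -> adicK n e -> eqmodX n W 0.
Proof.
move=> P; pose sp := {q : G * nat * 'M[k]_2 | special q.1.1 q.1.2 q.2}.
have [m [c [q [ee eW]]]] : exists m (c : 'I_m -> k) (q : 'I_m -> sp),
    e = \sum_(i < m) c i *: phi (sval (q i)).1.1 /\
    W = \sum_(i < m) (c i *: 'X^((sval (q i)).1.2)) *: map_mx polyC (sval (q i)).2.
  suff [r [-> ->]] : exists r : seq (k * sp),
      e = \sum_(p <- r) p.1 *: phi (sval p.2).1.1 /\
      W = \sum_(p <- r) (p.1 *: 'X^((sval p.2).1.2)) *: map_mx polyC (sval p.2).2.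
    exists (size r), (fun i => (tnth (in_tuple r) i).1), (fun i => (tnth (in_tuple r) i).2).
    by rewrite !(big_tnth _ _ r).
  elim: P => [|c g j A {}e {}W sg _ _ [r [-> ->]]]; first by exists [::]; rewrite !big_nil.
  by exists ((c, exist (fun q => special q.1.1 q.1.2 q.2) (g, j, A) sg) :: r); rewrite !big_cons.
pose dg i := (sval (q i)).1.2; pose gg i := (sval (q i)).1.1.
(* The coefficient of [t^j]: stripping the power of [t] from each term of degree [j] leaves an
   element of [base]. *)
pose cf (j : nat) : D := \sum_(i | dg i == j) c i *: (phi (gg i) * t ^- dg i).
have Kcf j : base (cf j).
  apply: (dsr_sum baseD) => i _; rewrite -[_ * _]mul1r scalerAl.
  by apply: (dsrM baseD); [exact: base_scal | exact: special_factor (svalP (q i))].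
pose J := (\max_i dg i).+1.
have tu i : t ^+ i \is a GRing.unit by rewrite unitrX // (emb_unit emb).
have eJ : e = \sum_(j < J) cf j * t ^+ j.
  rewrite ee; under [RHS]eq_bigr do rewrite /cf mulr_suml.
  rewrite (exchange_big_dep predT) //=; apply: eq_bigr => i _.
  have ltJ : (dg i < J)%N by rewrite ltnS; apply: leq_bigmax.
  rewrite (big_pred1 (Ordinal ltJ)) => [|j]; last by rewrite /= -val_eqE /= eq_sym.
  by rewrite /= -scalerAl mulrVK.
rewrite eJ => /(adic_coef0 Ddiv baseD t0 normalizes_base t_lindep Kcf) cf0.
have rel0 j : (j < n)%N -> \sum_(i | dg i == j) c i *: (sval (q i)).2 = 0.
  (* Transporting the relation requires a function on all of [G], so the relation [special] is made
     one, with value 0 where it is undefined. *)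
  move=> jn; pose F (g : G) : 'M[k]_2 := 
    if pselect (exists A, special g j A) is left h then projT1 (cid h) else 0.
  have FE i : dg i == j -> F (gg i) = (sval (q i)).2.
    move=> /eqP e0; rewrite /F; have := svalP (q i); rewrite -/(dg i) -/(gg i) e0 => sp0.
    case: pselect => [h|[]]; last by exists (sval (q i)).2.
    by case: (cid h) => A /= /(special_inj sp0)[_ ->].
  transitivity (\sum_(i | dg i == j) c i *: F (gg i)).
    by apply: eq_bigr => i /FE ->.
  apply: (emb_linear_relation emb).
  have -> : \sum_(i | dg i == j) c i *: phi (gg i) = cf j * t ^+ j.
    rewrite /cf mulr_suml; apply: eq_bigr => i /eqP <-.
    by rewrite -scalerAl mulrVK.
  have [jJ|Jj] := ltnP j J; first by rewrite cf0 ?mul0r.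
  rewrite /cf big_pred0 ?mul0r // => i; apply: negbTE; rewrite neq_ltn.
  by rewrite (leq_trans _ Jj) // ltnS; apply: leq_bigmax.
exists (map_mx (drop_poly n) W); rewrite add0r; apply/matrixP => a b; rewrite !mxE.
rewrite -[LHS](poly_take_drop n) mulrC.
suff -> : take_poly n (W a b) = 0 by rewrite add0r.
apply/polyP => j; rewrite coef_take_poly coef0; case: ifP => // jn.
rewrite eW summxE coef_sum.
have := congr1 (fun A : 'M[k]_2 => A a b) (rel0 j jn).
rewrite summxE [RHS]mxE => s0; rewrite -[RHS]s0 [RHS]big_mkcond; apply: eq_bigr => i _.
rewrite !mxE coefMC coefZ coefXn eq_sym -/(dg i).
by case: eqP => _; rewrite ?mulr1 // mulr0 mul0r.
Qed.

Lemma eqmodX_refl n A : eqmodX n A A.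
Proof. by exists 0; rewrite scaler0 addr0. Qed.

Lemma eqmodX_sym n A B : eqmodX n A B -> eqmodX n B A.
Proof. by move=> [C ->]; exists (- C); rewrite scalerN addrK. Qed.

Lemma eqmodX_trans n A B C : eqmodX n A B -> eqmodX n B C -> eqmodX n A C.
Proof. by move=> [E ->] [F ->]; exists (F + E); rewrite scalerDr addrA. Qed.

Lemma eqmodXD n A B A' B' : eqmodX n A B -> eqmodX n A' B' -> eqmodX n (A + A') (B + B').
Proof. by move=> [E ->] [F ->]; exists (E + F); rewrite scalerDr addrACA. Qed.

Lemma eqmodXMl n A B C : eqmodX n A B -> eqmodX n (C * A) (C * B).
Proof. by move=> [E ->]; exists (C * E); rewrite mulrDr scalerAr. Qed.

Lemma eqmodXMr n A B C : eqmodX n A B -> eqmodX n (A * C) (B * C).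
Proof. by move=> [E ->]; exists (E * C); rewrite mulrDl scalerAl. Qed.

Lemma eqmodXM n A B A' B' : eqmodX n A B -> eqmodX n A' B' -> eqmodX n (A * A') (B * B').
Proof. by move=> h h'; apply: eqmodX_trans (eqmodXMr _ h) (eqmodXMl _ h'). Qed.

Lemma eqmodXZ n (p : {poly k}) A B : eqmodX n A B -> eqmodX n (p *: A) (p *: B).
Proof. by move=> [E ->]; exists (p *: E); rewrite scalerDr !scalerA mulrC. Qed.

(** Taking [n] to be the size of an entry of [A - B] forces that entry to vanish. *)
Lemma eqmodX_eq A B : (forall n, eqmodX n A B) -> A = B.
Proof.
move=> h; apply/eqP; rewrite -subr_eq0; apply/eqP/matrixP => i j; rewrite [RHS]mxE.
set p := _ i j; have [C e] := h (size p).
have ep : p = 'X^(size p) * C i j by rewrite {1}/p e addrAC subrr add0r mxE.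
apply/polyP => l; rewrite coef0; have [ls|/leq_sizeP -> //] := ltnP l (size p).
by rewrite ep coefXnM ls.
Qed.

(* specializes m d W p: the expansion of d in powers of Y has coefficients in k[G],
   starts in degree at least m, and its value at x, y is the fraction W / p. *)
Definition specializes m d (W : 'M[{poly k}]_2) (p : {poly k}) :=
  forall n, exists q V, [/\ spec_pol m q V, adicK n (d - q) & eqmodX n (p *: V) W].

Lemma specializes_pol m e W : spec_pol m e W -> specializes m e W 1.
Proof.
move=> P n; exists e, W; rewrite subrr scale1r; split=> //; last exact: eqmodX_refl.
exact: spec_pol_adic (SpecPol0 n).
Qed.

(** The denominator is arbitrary because [specializesD] only adds fractions with equal
    denominators. *)
Lemma specializes_one p : specializes 0 1 p%:M p.
Proof.
move=> n; exists 1, 1; rewrite subrr scalemx1; split; last exact: eqmodX_refl.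
  by have := spec_pol_scal 1; rewrite scale1r.
exact: spec_pol_adic (SpecPol0 n).
Qed.

Lemma specializes_adic m d W p : specializes m d W p -> adicK m d.
Proof.
move=> /(_ m) [q [V [P a _]]]; rewrite -(subrK q d); apply: adD => //.
exact: spec_pol_adic P.
Qed.

Lemma specializes_weaken m n d W p : (n <= m)%N -> specializes m d W p ->
  specializes n d W p.
Proof.
move=> nm h l; have [q [V [P a e]]] := h l; exists q, V; split=> //.
exact: spec_pol_weaken P.
Qed.

Lemma specializesD m d W d' W' p : specializes m d W p -> specializes m d' W' p ->
  specializes m (d + d') (W + W') p.
Proof.
move=> h h' n; have [q [V [P a e]]] := h n; have [q' [V' [P' a' e']]] := h' n.
exists (q + q'), (V + V'); split; first exact: spec_polD.
  by rewrite opprD addrACA; apply: adD.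
by rewrite scalerDr; apply: eqmodXD.
Qed.

Lemma specializesM m d W p m' d' W' p' :
  specializes m d W p -> specializes m' d' W' p' ->
  specializes (m + m') (d * d') (W * W') (p * p').
Proof.
move=> h h' n; have [q [V [P a e]]] := h n; have [q' [V' [P' a' e']]] := h' n.
exists (q * q'), (V * V'); split; first exact: spec_polM.
  have -> : d * d' - q * q' = (d - q) * d' + q * (d' - q').
    by rewrite mulrBl mulrBr addrA subrK.
  apply: adD => //.
    rewrite -[n]addn0; apply: adM => //.
    exact/(specializes_adic (specializes_weaken (leq0n m') h')).
  rewrite -[n]add0n; apply: adM => //.
  exact: spec_pol_adic (spec_pol_weaken (leq0n m) P).
by rewrite -scalerA scalerAr scalerAl; apply: eqmodXM.
Qed.

(** [U'] acts as an adjugate of [p + W], with [r] in place of the determinant. Truncated geometric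
    series approximate the inverse because [e] has positive degree. *)
Lemma specializesV e W p U' r : specializes 1 e W p -> U' * (p%:M + W) = r%:M ->
  1 + e != 0 /\ specializes 0 (1 + e)^-1 (p *: U') r.
Proof.
move=> h eU; have ae := specializes_adic h.
have [d0 aV] := adic_unit Ddiv baseD t0 normalizes_base baseK_free ae; split=> // n.
have [q [V [P a eV]]] := h n.
pose q' := \sum_(i < n) (- q) ^+ i; pose V' := \sum_(i < n) (- V) ^+ i.
have geo (R : nzRingType) (b : R) : (1 + b) * \sum_(i < n) (- b) ^+ i = 1 - (- b) ^+ n.
  by rewrite -[RHS]opprB subrX1 -mulNr opprB opprK.
have P' : spec_pol 0 q' V'.
  rewrite /q' /V'; elim: n {h a eV q' V' geo} => [|n IH].
    by rewrite !big_ord0; apply: SpecPol0.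
  rewrite !big_ord_recr /=; apply: spec_polD => //.
  exact: spec_pol_weaken (spec_polX n (spec_polN P)).
exists q', V'; split=> //.
  (* This follows from [(1 + q) q' = 1 - (-q)^n]; both error terms lie in step [n] of the
     filtration. *)
  have -> : (1 + e)^-1 - q' = (1 + e)^-1 * ((- q) ^+ n - (e - q) * q').
    apply: (mulrI (Ddiv d0)); rewrite mulrBr divrr ?mulVKr; try exact: Ddiv.
    have -> : 1 + e = (1 + q) + (e - q) by rewrite -addrA (addrCA q) subrr addr0.
    by rewrite mulrDl geo opprD opprB addrA addrCA subrr addr0.
  rewrite -[n]add0n; apply: adM => //; apply: adB => //.
    have /spec_pol_adic := spec_polX n (spec_polN P); by rewrite muln1.
  by rewrite -[n]addn0; apply: adM => //; apply: spec_pol_adic P'.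
have Vn : eqmodX n (p *: ((1 + V) * V')) p%:M.
  rewrite geo -[p%:M]scalemx1 -[1 in X in eqmodX n _ X]subr0; apply: eqmodXZ.
  have /spec_pol_eqmod := spec_polX n (spec_polN P); rewrite muln1 => -[C ->].
  by exists (- C); rewrite add0r scalerN subr0.
have -> : r *: V' = U' * ((p%:M + W) * V') by rewrite mulrA eU -mul_scalar_mx.
have -> : p *: U' = U' * p%:M by rewrite -[_ * _]/(_ *m _) mul_mx_scalar.
apply: eqmodXMl; apply: eqmodX_trans Vn; rewrite scalerAl.
apply: eqmodXMr; rewrite scalerDr; apply: eqmodXD; last exact: eqmodX_sym.
by rewrite scalemx1; apply: eqmodX_refl.
Qed.

(** An approximation [q] of 1 to order [n] has value 1 modulo ['X^n], by [spec_pol_adic_eqmod]; now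
    let [n] vary. *)
Lemma specializes_one_inj W p : specializes 0 1 W p -> W = p%:M.
Proof.
move=> h; apply: eqmodX_eq => n; have [q [V [P a e]]] := h n.
apply: eqmodX_trans (eqmodX_sym e) _.
have P1 : spec_pol 0 (1 - q) (1 - V).
  by apply: spec_polD; [have := spec_pol_scal 1; rewrite scale1r | exact: spec_polN].
have [C eC] := spec_pol_adic_eqmod P1 a.
rewrite -scalemx1; apply: eqmodXZ; apply: eqmodX_sym; exists C.
by rewrite -[X in _ = _ + X]add0r -eC addrCA subrr addr0.
Qed.

Lemma free_pair_specialized S B (w p : {poly k}) : (2%:R : k) != 0 ->
  specializes 1 S (w *: map_mx polyC (spec_y k)) p ->
  spec_pol 0 B (map_mx polyC (spec_x k)) ->
  w.[1] = p.[1] -> p.[1] != 0 ->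
  free_pair (1 + S) (1 + S * B * S).
Proof.
move=> k2 hS hB w1 p1.
pose mx := map_mx polyC (spec_x k); pose my := map_mx polyC (spec_y k).
have mxx : mx * mx = 1 by rewrite -[LHS]/(mx *m mx) -map_mxM [_ *m _]spec_xx map_mx1.
have myy : my * my = 1 by rewrite -[LHS]/(my *m my) -map_mxM [_ *m _]spec_yy map_mx1.
have myxy : my * mx * my = - mx.
  have mxy : mx * my = - (my * mx).
    by rewrite -[LHS]/(mx *m my) -map_mxM [_ *m _]spec_xy map_mxN map_mxM.
  by rewrite -mulrA mxy mulrN mulrA myy mul1r.
have hSBS : specializes 1 (S * B * S) (- (w ^+ 2 *: mx)) (p ^+ 2).
  have := specializesM (specializesM hS (specializes_pol hB)) hS.
  rewrite mulr1 -expr2 -!scalerAl -scalerAr scalerA -expr2 myxy scalerN.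
  exact: specializes_weaken.
(* Numerators of the two generators and their adjugates; the sign in [V] comes from [y x y = -x]. *)
pose U := p%:M + w *: my; pose U' := p%:M - w *: my.
pose V := (p ^+ 2)%:M - w ^+ 2 *: mx; pose V' := (p ^+ 2)%:M + w ^+ 2 *: mx.
have diff (a b : {poly k}) (A : 'M[{poly k}]_2) : A * A = 1 ->
    (a%:M - b *: A) * (a%:M + b *: A) = (a ^+ 2 - b ^+ 2)%:M.
  move=> AA; have sc (e : {poly k}) : e%:M = e *: 1 :> 'M[{poly k}]_2 by rewrite scalemx1.
  rewrite !sc mulrDr !mulrDl !mulNr -!scalerAl -!scalerAr !scalerA !mul1r !mulr1 AA.
  by rewrite (mulrC b a) addrA subrK -scalerBl.
have eU : U' * U = (p ^+ 2 - w ^+ 2)%:M by apply: diff.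
have eV : V' * V = ((p ^+ 2) ^+ 2 - (w ^+ 2) ^+ 2)%:M.
  have := diff (p ^+ 2) (- w ^+ 2) mx mxx.
  by rewrite !scaleNr opprK sqrrN.
have [u0 hUV] := specializesV hS eU; have [v0 hVV] := specializesV hSBS eV.
have hU : specializes 0 (1 + S) U p.
  by apply: specializesD; [exact: specializes_one | exact: specializes_weaken hS].
have hV : specializes 0 (1 + S * B * S) V (p ^+ 2).
  by apply: specializesD; [exact: specializes_one | exact: specializes_weaken hSBS].
pose M (l : bool * bool) := if l.1 then (if l.2 then U else p *: U')
  else (if l.2 then V else p ^+ 2 *: V').
pose r (l : bool * bool) := if l.1 then (if l.2 then p else p ^+ 2 - w ^+ 2)
  else (if l.2 then p ^+ 2 else (p ^+ 2) ^+ 2 - (w ^+ 2) ^+ 2).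
split; [exact: Ddiv | exact: Ddiv |] => wd wd0 red; apply/eqP => ew.
have : specializes 0 (eval_word (1 + S) (1 + S * B * S) wd)
    (\prod_(l <- wd) M l) (\prod_(l <- wd) r l).
  elim: wd {wd0 red ew} => [|l wd IH]; first by rewrite !big_nil; apply: specializes_one.
  rewrite !big_cons; apply: (specializesM (m := 0) (m' := 0)) IH.
  by case: l => [[] []].
(* The identity is free of denominators, so it can be evaluated at 1. There [r] vanishes on inverse
   letters and the scalar may be 0, but a product of rank one is no scalar matrix at all. *)
rewrite ew => /specializes_one_inj /(congr1 (map_mx (horner_eval 1))).
rewrite rmorph_prod map_scalar_mx /=.
(* The factors 2 appear because [1 - x] and [1 + x] are twice the letter matrices. *)
pose c (l : bool * bool) := if l.1 then (if l.2 then p.[1] else p.[1] ^+ 2)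
  else (if l.2 then p.[1] ^+ 2 * 2%:R else p.[1] ^+ 2 * p.[1] ^+ 2 * 2%:R).
apply/eqP; apply: (@reduced_prod_not_scalar _ _ (fun l => map_mx (horner_eval 1) (M l)) c) => //.
  by move=> [[] []]; rewrite /c /= ?mulf_neq0 ?expf_neq0.
have matE (a b : {poly k}) A : map_mx (horner_eval 1) (a%:M + b *: map_mx polyC A) =
    a.[1]%:M + b.[1] *: A.
  apply/matrixP => i j; rewrite !mxE /= /horner_eval.
  by rewrite hornerD hornerMn hornerM hornerC.
move=> [[] []]; rewrite /M /c /=.
- rewrite matE w1; apply/matrixP => i j; rewrite !mxE big_ord1 !mxE.
  by case: (ord2P i) => ->; case: (ord2P j) => -> /=; rewrite ?(mulr0, mulr1, addr0, add0r, mulr1n, mulr0n).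
- rewrite map_mxZ /U' -scaleNr matE hornerN w1; apply/matrixP => i j; rewrite !mxE big_ord1 !mxE.
  rewrite /= /horner_eval.
  by case: (ord2P i) => ->; case: (ord2P j) => -> /=;
    rewrite ?(mulr0, mulr1, addr0, add0r, mulr1n, mulr0n, mulrN, mulNr, opprK) ?expr2.
- rewrite /V -scaleNr matE hornerN !horner_exp w1; apply/matrixP => i j; rewrite !mxE big_ord1 !mxE.
  by case: (ord2P i) => ->; case: (ord2P j) => -> /=;
    rewrite ?(mulr0, mulr1, addr0, add0r, mulr1n, mulr0n, mulrN, mulNr, opprK, subrr, mulr2n, mulrDr).
rewrite map_mxZ /V' matE !horner_exp w1; apply/matrixP => i j; rewrite !mxE big_ord1 !mxE.
rewrite /= /horner_eval !horner_exp.
by case: (ord2P i) => ->; case: (ord2P j) => -> /=;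
  rewrite ?(mulr0, mulr1, addr0, add0r, mulr1n, mulr0n, mulrN, mulNr, opprK, subrr, mulr2n, mulrDr).
Qed.

Lemma spec_y_average Y' : (2%:R : k) != 0 -> pi Y' = y ->
  specializes 1 (2%:R^-1 *: (t + phi Y')) ('X *: map_mx polyC (spec_y k)) 1.
Proof.
move=> k2 eY'; apply: specializes_pol; rewrite scalerDr.
have -> : 'X *: map_mx polyC (spec_y k) =
    (2%:R^-1 *: 'X^1) *: map_mx polyC (spec_y k) + (2%:R^-1 *: 'X^1) *: map_mx polyC (spec_y k).
  rewrite -scalerDl -scalerDl expr1; congr (_ *: _).
  by rewrite -mulr2n -[_ *+ 2]mulr_natr mulVf // scale1r.
by apply: spec_polD; apply: spec_pol1 => //; apply: special_y.
Qed.

Lemma spec_x_average X' : (2%:R : k) != 0 -> pi X' = x \/ pi X' = ginv x ->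
  spec_pol 0 (2%:R^-1 *: (phi X + phi X')) (map_mx polyC (spec_x k)).
Proof.
move=> k2 eX'; rewrite scalerDr.
have -> : map_mx polyC (spec_x k) =
    (2%:R^-1 *: 'X^0) *: map_mx polyC (spec_x k) + (2%:R^-1 *: 'X^0) *: map_mx polyC (spec_x k).
  rewrite -scalerDl -scalerDl expr0 -mulr2n -[_ *+ 2]mulr_natr mulVf //.
  by rewrite !scale1r.
by apply: spec_polD; apply: spec_pol1 => //; apply: special_x => //; left.
Qed.

(** [Y + Y' = Y' (1 + E)] with [E] of degree 2 and value ['X^2], so the inverse has value
    ['X y / (1 + 'X^2)]. The factor 2 makes numerator and denominator agree at 1. *)
Lemma spec_y_inverse Y' : pi Y' = ginv y -> t + phi Y' != 0 /\
  specializes 1 (2%:R *: (t + phi Y')^-1)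
    ((2%:R * 'X) *: map_mx polyC (spec_y k)) (1 + 'X ^+ 2).
Proof.
move=> eY'; pose F := ginv Y'; pose E := gmul F Y.
have sF : special F 1 (spec_y k) by apply: special_y; rewrite piV eY' ginvK.
have sE : special E 2 1.
  by have := specialM sF (special_y (erefl y)); rewrite spec_yy.
have hE : specializes 1 (phi E) ('X^2 *: 1) 1.
  apply: (@specializes_weaken 2) => //; apply: specializes_pol.
  by have := spec_pol1 1 sE (leqnn 2); rewrite !scale1r [map_mx _ _]map_mx1.
have e1 : 1 * (1%:M + 'X^2 *: 1) = (1 + 'X^2)%:M :> 'M[{poly k}]_2.
  by rewrite mul1r scalemx1 -raddfD.
have [E0 hV] := specializesV hE e1.
have eT : t + phi Y' = phi Y' * (1 + phi E).
  by rewrite mulrDr mulr1 -(embM emb) /E /F gmulVKg addrC.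
split; first by rewrite eT; apply: divring_mul_neq0 => //; apply: emb_neq0.
have hF : specializes 1 (phi F) ('X^1 *: map_mx polyC (spec_y k)) 1.
  by apply: specializes_pol; have := spec_pol1 1 sF (leqnn 1); rewrite !scale1r.
have := specializesM (specializes_pol (spec_pol_scal 2%:R)) (specializesM hV hF).
have -> : 2%:R *: (t + phi Y')^-1 = 2%:R%:A * ((1 + phi E)^-1 * phi F).
  by rewrite eT invrM ?(emb_unit emb) ?Ddiv // (embV emb) -scalerAl mul1r.
have -> : (2%:R%:P%:M * (1 *: 1 * ('X^1 *: map_mx polyC (spec_y k))) : 'M[{poly k}]_2) =
    (2%:R * 'X) *: map_mx polyC (spec_y k).
  by rewrite scale1r mul1r -[LHS]/(_ *m _) mul_scalar_mx scalerA expr1 polyCMn.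
by rewrite mul1r mulr1.
Qed.

End Specialization.

(** * Construction of the free symmetric pair *)

Theorem theorem3p2
  (k : fieldType) (G : group) (gst : G -> G) (N : G -> Prop)
  (Q : group) (pi : G -> Q)
  (D : unitAlgType k) (phi : G -> D) (dst : D -> D) :
  (* char k <> 2 *)
  (2%:R : k) != 0 ->
  (* * is an involution on G *)
  group_involution gst ->
  (* N is a *-invariant normal subgroup *)
  normal_subgroup N ->
  (forall x, N x -> N (gst x)) ->
  (* Q together with pi is the quotient G/N *)
  group_hom pi ->
  (forall q : Q, exists g, pi g = q) ->
  (forall g, pi g = gone <-> N g) ->
  (* G/N is nonabelian, torsion-free, nilpotent *)
  nonabelian Q -> torsion_free Q -> nilpotent_group Q ->
  (* D is a division ring and phi induces an embedding k[G] -> D *)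
  is_division_ring D ->
  group_algebra_embedding phi ->
  (* the embedding is good for k[N]: (i) *)
  orderable Q ->
  (* (ii) *)
  (forall (F : unitRingType) (R : nzRingType) (sigma : Q -> F -> F)
          (tau : Q -> Q -> F) (iota : F -> R) (u : Q -> R),
      is_division_ring F -> is_crossed_product sigma tau iota u -> ore_domain R) ->
  (* (iii) *)
  (exists x : Q -> G, (forall a, pi (x a) = a) /\
     forall (s : seq Q) (d : Q -> D), List.NoDup s ->
       (forall a, divsub phi N (d a)) ->
       \sum_(a <- s) d a * phi (x a) = 0 -> forall a, List.In a s -> d a = 0) ->
  (* the induced k-involution on k[G] extends to a k-involution dst of D *)
  k_involution dst ->
  (forall g, dst (phi g) = phi (gst g)) ->
  (* conclusion: D_G contains a free symmetric pair *)
  exists u v : D,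
    [/\ divsub phi (fun _ => True) u, divsub phi (fun _ => True) v,
        dst u = u, dst v = v & free_pair u v].
Proof.
move=> k2 [gstM gstK] nN Nst pih _ piN nab tf nil Ddiv emb _ _ [tr [trK trfree]].
move=> [dstD dstZ dstM dstK] dstphi.
(* The involution induced on [Q]; invariance of [N] makes it independent of the chosen lifts. *)
pose qst (a : Q) := pi (gst (tr a)).
have qstE g : pi (gst g) = qst (pi g).
  have -> : g = gmul (gmul g (ginv (tr (pi g)))) (tr (pi g)) by gsimp.
  rewrite gstM pih; set n := gmul g _.
  have -> : pi (gst n) = gone.
    by apply/piN/Nst/piN; rewrite /n pih (ghomV pih) trK gmulgV.
  by rewrite gmulg1 /qst /n -gmulA gmulV gmulg1.
have qinv : group_involution qst.
  split=> [a b|a].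
    by rewrite -{1}(trK a) -{1}(trK b) -pih -qstE gstM pih.
  by rewrite -(trK a) -!qstE gstK.
have [x [y [z [zc z1 xyz ex ey]]]] := nilpotent_heisenberg_pair qinv nab tf nil.
pose X := tr x; pose Y := tr y; pose Z := tr z.
rewrite -(trK x) -(trK y) -(trK z) -!qstE -/X -/Y -/Z in zc z1 xyz ex ey.
have dst1 : dst 1 = 1.
  by rewrite -[RHS]dstK -[dst 1 in RHS]mulr1 dstM dstK mulr1.
have dst0 : dst 0 = 0 by apply: (addrI (dst 0)); rewrite -dstD !addr0.
have dstV d : dst d^-1 = (dst d)^-1.
  have [->|d0] := eqVneq d 0; first by rewrite invr0 dst0 invr0.
  have dd0 : dst d != 0 by apply: contra d0 => /eqP e; rewrite -(dstK d) e dst0.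
  by apply: (mulIr (Ddiv _ dd0)); rewrite -dstM divrr ?mulVr ?dst1 //; apply: Ddiv.
have dstS g : dst (phi g + phi (gst g)) = phi g + phi (gst g).
  by rewrite dstD !dstphi gstK addrC.
pose DG := divsub phi (fun _ => True).
have DGd : division_subring DG by apply: divsub_dsr.
have DGphi g : DG (phi g) by apply: ds_grp.
have DGZ (a : k) d : DG d -> DG (a *: d).
  by move=> hd; rewrite -[d]mul1r scalerAl; apply: (dsrM DGd) => //; apply: ds_scal.
have DGS g : DG (phi g + phi (gst g)) by apply: (dsrD DGd).
pose B := 2%:R^-1 *: (phi X + phi (gst X)).
have hB := spec_x_average phi Y Z k2 ex.
have [S [w [p [DS eS hS w1 p1]]]] : exists S w p, [/\ DG S, dst S = S,
    specializes N pi phi X Y Z 1 S (w *: map_mx polyC (spec_y k)) p,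
    w.[1] = p.[1] & p.[1] != 0].
  case: ey => ey.
    exists (2%:R^-1 *: (phi Y + phi (gst Y))), 'X, 1; split.
    - exact: DGZ.
    - by rewrite dstZ dstS.
    - exact: (spec_y_average nN pih piN tf Ddiv emb trK trfree zc z1 xyz k2 ey).
    - by rewrite hornerX hornerC.
    by rewrite hornerC oner_neq0.
  (* Here [phi Y + phi (gst Y)] has a term of degree -1 in [Y], so its inverse is the symmetric
     element of positive degree. *)
  have [T0 hT] := spec_y_inverse nN pih piN tf Ddiv emb trK trfree zc z1 xyz ey.
  exists (2%:R *: (phi Y + phi (gst Y))^-1), (2%:R * 'X), (1 + 'X ^+ 2); split=> //.
  - exact/DGZ/(dsrV DGd).
  - by rewrite dstZ dstV dstS.
  - by rewrite hornerM hornerX mulr1 hornerMn hornerD hornerXn expr1n !hornerC.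
  by rewrite hornerD hornerXn expr1n hornerC.
exists (1 + S), (1 + S * B * S).
have DB : DG B by apply/DGZ.
split.
- by apply: (dsrD DGd) => //; apply: (dsr1 DGd).
- apply: (dsrD DGd); first exact: (dsr1 DGd).
  by apply: (dsrM DGd) => //; apply: (dsrM DGd).
- by rewrite dstD dst1 eS.
- by rewrite dstD dst1 !dstM eS /B dstZ dstS mulrA.
exact: (free_pair_specialized nN pih piN tf Ddiv emb trK trfree zc z1 xyz k2 hS hB w1 p1).
Qed.
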